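(* Let $H$ be a Hopf algebra over a field $k$ with bijective antipode and $A$ a right coideal subalgebra of $H$. If $H$ is right flat over $A$ and right coflat over $C=H/HA^+$, then the algebra $A'={}^{\mathrm{co}\,C}H$ is a perfect left localization of $A$. In other words, $A'$ is flat as a right $A$-module and the inclusion map $A\to A'$ is an epimorphism in the category of rings.
   Context: $\Delta,\varepsilon$ are the comultiplication and counit of $H$. A right coideal subalgebra is a subalgebra $A\subset H$ with $\Delta(A)\subset A\otimes H$; $A^+=A\cap\ker\varepsilon$; $HA^+$ is a left ideal and coideal of $H$, so $C=H/HA^+$ is a coalgebra; $\pi:H\to C$ is the canonical surjection, $1_C=\pi(1)$, ${}^{\mathrm{co}\,C}H=\{h\in H\mid(\pi\otimes\mathrm{id})\Delta(h)=1_C\otimes h\}$, a subalgebra of $H$ containing $A$. $H$ is right flat over $A$ if it is flat as a right $A$-module. $H$ is right coflat over $C$ if, with $H$ a right $C$-comodule via $(\mathrm{id}\otimes\pi)\Delta$, the cotensor product functor $H\,\square_C\,?$ on left $C$-comodules is exact. *)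

(* Defs.v *)
From HB Require Import structures.
From mathcomp Require Import all_boot all_algebra.
From mathcomp Require Import boolp.
From mathcomp Require Import freeg.

Set Implicit Arguments.
Unset Strict Implicit.
Unset Printing Implicit Defensive.

Import GRing.Theory.

Local Open Scope ring_scope.
Local Open Scope quotient_scope.

Inductive zspan (V : zmodType) (X : V -> Prop) : V -> Prop :=
| zspan0 : zspan X 0
| zspan_gen x : X x -> zspan X x
| zspanB x y : zspan X x -> zspan X y -> zspan X (x - y).

Definition zspan_pred (V : zmodType) (X : V -> Prop) : {pred V} :=
  fun x => `[< zspan X x >].

Section ZSpan.
Variables (V : zmodType) (X : V -> Prop).

Lemma zspanP x : reflect (zspan X x) (x \in zspan_pred X).
Proof. exact: asboolP. Qed.

Fact zspan_zmod_closed : zmod_closed (zspan_pred X).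
Proof.
split; first by apply/zspanP; exact: zspan0.
by move=> x y /zspanP hx /zspanP hy; apply/zspanP; exact: zspanB.
Qed.

HB.instance Definition _ :=
  GRing.isZmodClosed.Build V (zspan_pred X) zspan_zmod_closed.

Lemma zspan_ker (W : zmodType) (f : {additive V -> W}) :
  (forall x, X x -> f x = 0) -> forall x, x \in zspan_pred X -> f x = 0.
Proof.
move=> fX x /zspanP; elim=> [|y /fX //|y z _ hy _ hz]; first exact: raddf0.
by rewrite raddfB hy hz subrr.
Qed.

End ZSpan.

Lemma zmod_morphismD (V W : zmodType) (f : V -> W) :
  zmod_morphism f -> {morph f : x y / x + y}.
Proof.
move=> fB; pose g : {additive V -> W} :=
  HB.pack_for {additive V -> W} f (GRing.isZmodMorphism.Build V W f fB).
exact: (raddfD g).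
Qed.

(** For families of endomorphisms [l a] of [M] and [r a] of [N] indexed by
  [a : I], [bten l r] is the free abelian group on [M * N] modulo
  biadditivity and the relations [(l a m, n) = (m, r a n)].  Both the tensor
  product over a noncommutative ring and the tensor product of vector spaces
  are instances of it. *)

Section Balanced.
Variables (I : Type) (M N : zmodType) (l : I -> M -> M) (r : I -> N -> N).

Local Notation F := {freeg (M * N) / int}.
Local Notation gen m n := (Freeg [:: (1%Z, (m, n))] : F).

Inductive bten_relator : F -> Prop :=
| RelDl m m' n : bten_relator (gen (m + m') n - (gen m n + gen m' n))
| RelDr m n n' : bten_relator (gen m (n + n') - (gen m n + gen m n'))
| RelM a m n : bten_relator (gen (l a m) n - gen m (r a n)).

Definition bten : Type := {ideal_quot (zspan_pred bten_relator)}.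

Local Notation Q := {ideal_quot (zspan_pred bten_relator)}.

(* The operations are named, rather than copied from the quotient, so that
   unification does not unfold them. *)
Definition bten_zero : bten := 0 : Q.
Definition bten_opp (x : bten) : bten := - (x : Q).
Definition bten_add (x y : bten) : bten := (x : Q) + (y : Q).

Fact bten_addA : associative bten_add. Proof. exact: (@addrA Q). Qed.
Fact bten_addC : commutative bten_add. Proof. exact: (@addrC Q). Qed.
Fact bten_add0 : left_id bten_zero bten_add. Proof. exact: (@add0r Q). Qed.
Fact bten_addN : left_inverse bten_zero bten_opp bten_add.
Proof. exact: (@addNr Q). Qed.

HB.instance Definition _ := gen_eqMixin bten.
HB.instance Definition _ := gen_choiceMixin bten.
HB.instance Definition _ :=
  GRing.isZmodule.Build bten bten_addA bten_addC bten_add0 bten_addN.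

Definition bten_pi (x : F) : bten := \pi_Q x.

Fact bten_pi_is_zmod_morphism : zmod_morphism bten_pi.
Proof. exact: (raddfB \pi_Q). Qed.

HB.instance Definition _ :=
  GRing.isZmodMorphism.Build F bten bten_pi bten_pi_is_zmod_morphism.

Definition bpure (m : M) (n : N) : bten := bten_pi (gen m n).

Record balanced (G : zmodType) (f : M -> N -> G) : Prop := Balanced {
  balDl : forall m m' n, f (m + m') n = f m n + f m' n;
  balDr : forall m n n', f m (n + n') = f m n + f m n';
  balM : forall a m n, f (l a m) n = f m (r a n) }.

Definition blift (G : zmodType) (f : M -> N -> G) (x : bten) : G :=
  fglift (fun p => f p.1 p.2 : zmodule G) (repr (x : Q)).

Fact bten_relator0 x :
  bten_relator x -> bten_pi x = 0.
Proof.
move=> xR; have <- : bten_pi 0 = 0 by exact: raddf0.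
apply/(@eqP Q); rewrite -Quotient.idealrBE subr0; apply/zspanP.
exact: zspan_gen.
Qed.

Lemma bpure_balanced : balanced bpure.
Proof.
split=> [m m' n|m n n'|a m n]; apply/eqP; rewrite -subr_eq0; apply/eqP.
- by have := bten_relator0 (RelDl m m' n); rewrite raddfB raddfD.
- by have := bten_relator0 (RelDr m n n'); rewrite raddfB raddfD.
- by have := bten_relator0 (RelM a m n); rewrite raddfB.
Qed.

Lemma bten_ind (P : bten -> Prop) :
  (forall m n, P (bpure m n)) -> (forall x y, P x -> P y -> P (x + y)) ->
  forall x, P x.
Proof.
move=> Pp PD; have [bDl bDr _] := bpure_balanced.
have p0 n : bpure 0 n = 0 by apply: (addIr (bpure 0 n)); rewrite -bDl !add0r.
have P0 : P 0 by rewrite -(p0 0).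
have PN m n : P (- bpure m n).
  suff -> : - bpure m n = bpure (- m) n by [].
  by apply/eqP; rewrite eq_sym -addr_eq0 -bDl addNr p0.
elim/(@quotW _ Q) => D; rewrite -/(bten_pi D) -(freeg_sumE D).
rewrite (raddf_sum bten_pi).
elim/big_ind: _ => // -[m n] _; move: (coeff _ _) => c.
have -> : Freeg [:: (c, (m, n))] = gen m n *~ c :> F by rewrite freeg_mulz intz.
rewrite (raddfMz bten_pi) -/(bpure m n).
case: c => c; rewrite ?NegzE ?mulrNz -?pmulrn; elim: c => [|c IHc] //.
- by rewrite mulrS; apply: PD => //; exact: Pp.
- exact: PN.
- by rewrite mulrS opprD; apply: PD => //; exact: PN.
Qed.

Section Lift.
Variables (G : zmodType) (f : M -> N -> G) (fB : balanced f).

Lemma blift_pi (x : F) :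
  blift f (bten_pi x) =
  fglift (fun p => f p.1 p.2 : zmodule G) x.
Proof.
have [fDl fDr fM] := fB.
pose h := fglift (fun p : M * N => f p.1 p.2 : zmodule G) : F -> zmodule G.
have hB : additive h by exact: lift_is_additive.
apply/eqP; rewrite -subr_eq0 /blift -/h -(hB _ _).
pose ha : {additive F -> zmodule G} :=
  HB.pack_for {additive F -> zmodule G} h
    (GRing.isZmodMorphism.Build F (zmodule G) h hB).
have hgen m n : ha (gen m n) = f m n by rewrite /= /h liftU /= scale1r.
apply/eqP; apply: (zspan_ker (f := ha) (X := bten_relator)).
  move=> {}x [m m' n|m n n'|a m n]; apply/eqP; rewrite raddfB subr_eq0;
    apply/eqP; rewrite ?raddfD !hgen; [exact: fDl|exact: fDr|exact: fM].
by rewrite Quotient.idealrBE reprK.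
Qed.

Lemma blift_pure m n : blift f (bpure m n) = f m n.
Proof. by rewrite blift_pi liftU scale1r. Qed.

Lemma blift_is_zmod_morphism : zmod_morphism (blift f).
Proof.
elim/(@quotW _ Q) => x; elim/(@quotW _ Q) => y; rewrite -!/(bten_pi _).
rewrite -(raddfB bten_pi) !blift_pi.
exact: (lift_is_additive (fun p : M * N => f p.1 p.2 : zmodule G)).
Qed.

End Lift.

End Balanced.

Section Bilin.
Variables (k : fieldType) (U V W : lmodType k).

Record bilin (f : U -> V -> W) : Prop := Bilin {
  bilDl : forall u u' v, f (u + u') v = f u v + f u' v;
  bilDr : forall u v v', f u (v + v') = f u v + f u v';
  bilZl : forall a u v, f (a *: u) v = a *: f u v;
  bilZr : forall a u v, f u (a *: v) = a *: f u v }.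

Lemma bilin_balanced (f : U -> V -> W) :
  bilin f -> balanced ( *:%R ) ( *:%R ) f.
Proof. by case=> fDl fDr fZl fZr; split=> // a u v; rewrite fZl fZr. Qed.

End Bilin.

Definition tens (k : fieldType) (V W : lmodType k) : Type :=
  @bten k V W ( *:%R ) ( *:%R ).

Notation "V ⊗ W" := (tens V W) (at level 40, left associativity).

HB.instance Definition _ (k : fieldType) (V W : lmodType k) :=
  GRing.Zmodule.on (tens V W).

Definition pure (k : fieldType) (V W : lmodType k) (v : V) (w : W) : V ⊗ W :=
  bpure _ _ v w.
Notation "v ⊗ₜ w" := (pure v w) (at level 40, left associativity).

Section TensLmod.
Variables (k : fieldType) (V W : lmodType k).

Lemma tens_ind (P : V ⊗ W -> Prop) :
  (forall v w, P (v ⊗ₜ w)) -> (forall x y, P x -> P y -> P (x + y)) ->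
  forall x, P x.
Proof. exact: bten_ind. Qed.

Lemma pureDl v v' w : (v + v') ⊗ₜ w = v ⊗ₜ w + v' ⊗ₜ w :> V ⊗ W.
Proof. exact: (balDl (bpure_balanced _ _)). Qed.

Lemma pureDr v w w' : v ⊗ₜ (w + w') = v ⊗ₜ w + v ⊗ₜ w' :> V ⊗ W.
Proof. exact: (balDr (bpure_balanced _ _)). Qed.

Lemma pureZlr a v w : (a *: v) ⊗ₜ w = v ⊗ₜ (a *: w) :> V ⊗ W.
Proof. exact: (balM (bpure_balanced _ _)). Qed.

Definition tens_scale (a : k) : V ⊗ W -> V ⊗ W :=
  blift (fun v w => (a *: v) ⊗ₜ w).

Fact tens_scale_balanced a :
  @balanced k V W ( *:%R ) ( *:%R ) (tens V W)
    (fun v w => (a *: v) ⊗ₜ w).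
Proof.
split=> [v v' w|v w w'|b v w]; rewrite ?scalerDr ?pureDl ?pureDr //.
by rewrite scalerA mulrC -scalerA pureZlr.
Qed.

Fact tens_scale_pure a v w : tens_scale a (v ⊗ₜ w) = (a *: v) ⊗ₜ w.
Proof. exact: (blift_pure (tens_scale_balanced a)). Qed.

Fact tens_scaleDr : right_distributive tens_scale +%R.
Proof.
move=> a; apply: zmod_morphismD.
exact: (blift_is_zmod_morphism (tens_scale_balanced a)).
Qed.

Fact tens_scaleA a b x :
  tens_scale a (tens_scale b x) = tens_scale (a * b) x.
Proof.
elim/tens_ind: x => [v w|x y hx hy]; first by rewrite !tens_scale_pure scalerA.
by rewrite !tens_scaleDr hx hy.
Qed.

Fact tens_scale1 : left_id 1 tens_scale.
Proof.
elim/tens_ind => [v w|x y hx hy]; first by rewrite tens_scale_pure scale1r.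
by rewrite tens_scaleDr hx hy.
Qed.

Fact tens_scaleDl x : {morph tens_scale^~ x : a b / a + b}.
Proof.
move=> a b; elim/tens_ind: x => [v w|x y hx hy].
  by rewrite !tens_scale_pure scalerDl pureDl.
by rewrite !tens_scaleDr hx hy addrACA.
Qed.

HB.instance Definition _ := GRing.Zmodule_isLmodule.Build k (tens V W)
  tens_scaleA tens_scale1 tens_scaleDr tens_scaleDl.

Lemma pureZl a v w : (a *: v) ⊗ₜ w = a *: (v ⊗ₜ w) :> V ⊗ W.
Proof. by rewrite -tens_scale_pure. Qed.

Lemma pureZr a v w : v ⊗ₜ (a *: w) = a *: (v ⊗ₜ w) :> V ⊗ W.
Proof. by rewrite -pureZlr pureZl. Qed.

Lemma pure_bilin : bilin (@pure k V W).
Proof. by split; [exact: pureDl|exact: pureDr|exact: pureZl|exact: pureZr]. Qed.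

Definition tlift (U : lmodType k) (f : V -> W -> U) : V ⊗ W -> U := blift f.

Section Lift.
Variables (U : lmodType k) (f : V -> W -> U) (fB : bilin f).

Lemma tlift_pure v w : tlift f (v ⊗ₜ w) = f v w.
Proof. exact: (blift_pure (bilin_balanced fB)). Qed.

Lemma tlift_is_linear : linear (tlift f).
Proof.
have hD : {morph tlift f : x y / x + y}.
  apply: zmod_morphismD; exact: (blift_is_zmod_morphism (bilin_balanced fB)).
have hZ a x : tlift f (a *: x) = a *: tlift f x.
  elim/tens_ind: x => [v w|x y hx hy].
    by rewrite -pureZl !tlift_pure (bilZl fB).
  by rewrite scalerDr !hD hx hy scalerDr.
by move=> a x y; rewrite hD hZ.
Qed.

End Lift.

Lemma tliftD (U : lmodType k) (f : V -> W -> U) :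
  bilin f -> {morph tlift f : x y / x + y}.
Proof. by move=> fB x y; rewrite -[x in LHS]scale1r tlift_is_linear ?scale1r. Qed.

Lemma tliftZ (U : lmodType k) (f : V -> W -> U) a :
  bilin f -> {morph tlift f : x / a *: x}.
Proof.
move=> fB x; have f0 : tlift f 0 = 0.
  by apply: (addrI (tlift f 0)); rewrite -tliftD // !addr0.
by rewrite -[a *: x in LHS]addr0 tlift_is_linear // f0 addr0.
Qed.

Lemma tens_ext (U : lmodType k) (f g : {linear V ⊗ W -> U}) :
  (forall v w, f (v ⊗ₜ w) = g (v ⊗ₜ w)) -> f =1 g.
Proof.
by move=> fg; elim/tens_ind => [//|x y hx hy]; rewrite !linearD hx hy.
Qed.

End TensLmod.

(* Failing unification problems would otherwise unfold tensors to
   quotients of free abelian groups. *)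
#[global] Opaque bten bpure blift pure tlift.

Section TensMap.
Variables (k : fieldType) (V V' W W' : lmodType k).
Variables (f : {linear V -> V'}) (g : {linear W -> W'}).

Definition tmap : V ⊗ W -> V' ⊗ W' := tlift (fun v w => f v ⊗ₜ g w).

Fact tmap_bilin : bilin (fun v w => f v ⊗ₜ g w).
Proof.
by split=> *; rewrite ?linearD ?linearZ ?pureDl ?pureDr /= ?pureZl ?pureZr.
Qed.

HB.instance Definition _ := GRing.isLinear.Build k (tens V W) (tens V' W') _ tmap
  (tlift_is_linear tmap_bilin).

Lemma tmapD : {morph tmap : x y / x + y}. Proof. exact: linearD. Qed.
Lemma tmapZ a : {morph tmap : x / a *: x}. Proof. exact: linearZ. Qed.

Lemma tmap_pure v w : tmap (v ⊗ₜ w) = f v ⊗ₜ g w.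
Proof. exact: (tlift_pure tmap_bilin). Qed.

End TensMap.
Notation "f ⊠ g" := (tmap f g) (at level 40, left associativity).

Definition lid (k : fieldType) (V : lmodType k) : {linear V -> V} := idfun.

Lemma tmap_comp (k : fieldType) (V1 V2 V3 W1 W2 W3 : lmodType k)
    (f : {linear V1 -> V2}) (f' : {linear V2 -> V3})
    (g : {linear W1 -> W2}) (g' : {linear W2 -> W3}) (x : V1 ⊗ W1) :
  (f' ⊠ g') ((f ⊠ g) x) = ((f' \o f)%FUN ⊠ (g' \o g)%FUN) x.
Proof.
elim/tens_ind: x => [v w|x y hx hy]; first by rewrite !tmap_pure.
by rewrite !tmapD hx hy.
Qed.

Lemma eq_tmap (k : fieldType) (V V' W W' : lmodType k)
    (f f' : {linear V -> V'}) (g g' : {linear W -> W'}) :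
  f =1 f' -> g =1 g' -> f ⊠ g =1 f' ⊠ g'.
Proof.
move=> ff' gg'; elim/tens_ind => [v w|x y hx hy].
  by rewrite !tmap_pure ff' gg'.
by rewrite !tmapD hx hy.
Qed.

Section TensAssoc.
Variables (k : fieldType) (U V W : lmodType k).

Definition tassoc : (U ⊗ V) ⊗ W -> U ⊗ (V ⊗ W) :=
  tlift (fun x w => tlift (fun u v => u ⊗ₜ (v ⊗ₜ w)) x).

Fact tassoc_bilin1 (w : W) : bilin (fun (u : U) (v : V) => u ⊗ₜ (v ⊗ₜ w)).
Proof. by split=> *; rewrite ?pureDl ?pureDr ?pureZl ?pureZr. Qed.

Fact tassoc_bilin :
  bilin (fun x (w : W) => tlift (fun (u : U) (v : V) => u ⊗ₜ (v ⊗ₜ w)) x).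
Proof.
have B := tassoc_bilin1.
split=> [x x' w|x w w'|a x w|a x w]; rewrite ?tliftD ?tliftZ //.
- elim/tens_ind: x => [u v|x y hx hy]; first by rewrite !tlift_pure // !pureDr.
  by rewrite !tliftD // hx hy addrACA.
- elim/tens_ind: x => [u v|x y hx hy]; first by rewrite !tlift_pure // !pureZr.
  by rewrite !tliftD // hx hy scalerDr.
Qed.

HB.instance Definition _ := GRing.isLinear.Build k (tens (tens U V) W) (tens U (tens V W))
  _ tassoc (tlift_is_linear tassoc_bilin).

Lemma tassocD : {morph tassoc : x y / x + y}. Proof. exact: linearD. Qed.
Lemma tassocZ a : {morph tassoc : x / a *: x}. Proof. exact: linearZ. Qed.

Lemma tassoc_pure u v w : tassoc ((u ⊗ₜ v) ⊗ₜ w) = u ⊗ₜ (v ⊗ₜ w).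
Proof.
rewrite /tassoc (tlift_pure tassoc_bilin).
exact: (tlift_pure (tassoc_bilin1 w)).
Qed.

End TensAssoc.

Lemma tassoc_tmap (k : fieldType) (U U' V V' W W' : lmodType k)
    (f : {linear U -> U'}) (g : {linear V -> V'}) (h : {linear W -> W'})
    (x : (U ⊗ V) ⊗ W) :
  tassoc (((f ⊠ g) ⊠ h) x) = (f ⊠ (g ⊠ h)) (tassoc x).
Proof.
elim/tens_ind: x => [u w|x y hx hy]; last by rewrite !(tmapD, tassocD) hx hy.
elim/tens_ind: u => [u v|x y hx hy]; last first.
  by rewrite !pureDl !(tmapD, tassocD) hx hy.
by rewrite tassoc_pure !tmap_pure /= !tmap_pure tassoc_pure.
Qed.

(** [tcontl e] and [tcontr e] are [e ⊗ id] and [id ⊗ e] followed by the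
    identifications [k ⊗ W = W] and [V ⊗ k = V]. *)
Section TensContract.
Variables (k : fieldType) (V W : lmodType k).

Definition tcontl (e : {scalar V}) : V ⊗ W -> W := tlift (fun v w => e v *: w).
Definition tcontr (e : {scalar W}) : V ⊗ W -> V := tlift (fun v w => e w *: v).

Fact tcontl_bilin (e : {scalar V}) : bilin (fun v (w : W) => e v *: w).
Proof.
split=> [v v' w|v w w'|a v w|a v w].
- by rewrite linearD scalerDl.
- by rewrite scalerDr.
- by rewrite linearZ scalerA.
- by rewrite !scalerA mulrC.
Qed.

Fact tcontr_bilin (e : {scalar W}) : bilin (fun (v : V) w => e w *: v).
Proof.
split=> [v v' w|v w w'|a v w|a v w].
- by rewrite scalerDr.
- by rewrite linearD scalerDl.
- by rewrite !scalerA mulrC.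
- by rewrite linearZ scalerA.
Qed.

HB.instance Definition _ e := GRing.isLinear.Build k (tens V W) W _ (tcontl e)
  (tlift_is_linear (tcontl_bilin e)).
HB.instance Definition _ e := GRing.isLinear.Build k (tens V W) V _ (tcontr e)
  (tlift_is_linear (tcontr_bilin e)).

Lemma tcontlD (e : {scalar V}) : {morph tcontl e : x y / x + y}.
Proof. exact: linearD. Qed.

Lemma tcontrD (e : {scalar W}) : {morph tcontr e : x y / x + y}.
Proof. exact: linearD. Qed.

Lemma tcontl_pure (e : {scalar V}) v w : tcontl e (v ⊗ₜ w) = e v *: w.
Proof. exact: (tlift_pure (tcontl_bilin e)). Qed.

Lemma tcontr_pure (e : {scalar W}) v w : tcontr e (v ⊗ₜ w) = e w *: v.
Proof. exact: (tlift_pure (tcontr_bilin e)). Qed.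

End TensContract.

Section TensAlg.
Variables (k : fieldType) (A B : algType k).

Fact tens_mul_bilin1 (a : A) (b : B) :
  bilin (fun c d => (a * c) ⊗ₜ (b * d)).
Proof.
by split=> *; rewrite ?mulrDr -?scalerAr ?pureDl ?pureDr ?pureZl ?pureZr.
Qed.

Definition tens_mul (x y : A ⊗ B) : A ⊗ B :=
  tlift (fun a b => tlift (fun c d => (a * c) ⊗ₜ (b * d)) y) x.

Fact tens_mul_bilin2 (y : A ⊗ B) :
  bilin (fun a b => tlift (fun c d => (a * c) ⊗ₜ (b * d)) y).
Proof.
have L a b := tens_mul_bilin1 a b.
split=> [a a' b|a b b'|s a b|s a b];
  elim/tens_ind: y => [c d|y z hy hz]; rewrite ?(tliftD (L _ _)) ?hy ?hz;
  rewrite ?(tlift_pure (L _ _)) ?mulrDl -?scalerAl ?pureDl ?pureDr ?pureZl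
    ?pureZr ?scalerDr //.
all: by rewrite addrACA.
Qed.

Fact tens_mul_pure a b c d :
  tens_mul (a ⊗ₜ b) (c ⊗ₜ d) = (a * c) ⊗ₜ (b * d).
Proof.
by rewrite /tens_mul (tlift_pure (tens_mul_bilin2 _)) (tlift_pure (tens_mul_bilin1 _ _)).
Qed.

Fact tens_mulDl : left_distributive tens_mul +%R.
Proof. by move=> x y z; exact: (tliftD (tens_mul_bilin2 z)). Qed.

Fact tens_mulDr : right_distributive tens_mul +%R.
Proof.
move=> x y z; elim/tens_ind: x => [a b|x x' hx hx'].
  by rewrite /tens_mul !(tlift_pure (tens_mul_bilin2 _))
    (tliftD (tens_mul_bilin1 _ _)).
by rewrite !tens_mulDl hx hx' addrACA.
Qed.

Fact tens_mulA : associative tens_mul.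
Proof.
move=> x y z; elim/tens_ind: x => [a b|x x' hx hx']; last first.
  by rewrite !tens_mulDl hx hx'.
elim/tens_ind: y => [c d|y y' hy hy']; last first.
  by rewrite !(tens_mulDl, tens_mulDr) hy hy'.
elim/tens_ind: z => [e f|z z' hz hz']; last by rewrite !tens_mulDr hz hz'.
by rewrite !tens_mul_pure !mulrA.
Qed.

Fact tens_mul1l : left_id (1 ⊗ₜ 1) tens_mul.
Proof.
elim/tens_ind => [a b|x y hx hy]; first by rewrite tens_mul_pure !mul1r.
by rewrite tens_mulDr hx hy.
Qed.

Fact tens_mul1r : right_id (1 ⊗ₜ 1) tens_mul.
Proof.
elim/tens_ind => [a b|x y hx hy]; first by rewrite tens_mul_pure !mulr1.
by rewrite tens_mulDl hx hy.
Qed.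

HB.instance Definition _ := GRing.Zmodule_isPzRing.Build (A ⊗ B)
  tens_mulA tens_mul1l tens_mul1r tens_mulDl tens_mulDr.

Lemma pureM (a c : A) (b d : B) :
  (a ⊗ₜ b) * (c ⊗ₜ d) = (a * c) ⊗ₜ (b * d).
Proof. exact: tens_mul_pure. Qed.

Lemma pure1 : 1 = 1 ⊗ₜ 1 :> A ⊗ B.
Proof. by []. Qed.

End TensAlg.

Section TensMult.
Variables (k : fieldType) (A : algType k).

Definition tmult : A ⊗ A -> A := tlift *%R.

Fact mul_bilin : bilin ( *%R : A -> A -> A).
Proof.
by split=> *; rewrite ?mulrDl ?mulrDr -?scalerAl -?scalerAr.
Qed.

HB.instance Definition _ := GRing.isLinear.Build k (A ⊗ A) A _ tmult
  (tlift_is_linear mul_bilin).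

Lemma tmult_pure a b : tmult (a ⊗ₜ b) = a * b.
Proof. exact: (tlift_pure mul_bilin). Qed.

End TensMult.

Record is_coalgebra (k : fieldType) (V : lmodType k)
    (comul : {linear V -> V ⊗ V}) (counit : {scalar V}) : Prop := IsCoalgebra {
  coalg_assoc : forall x,
    tassoc ((comul ⊠ lid V) (comul x)) = (lid V ⊠ comul) (comul x);
  coalg_unitl : forall x, tcontl counit (comul x) = x;
  coalg_unitr : forall x, tcontr counit (comul x) = x }.

Record coalgebra (k : fieldType) := Coalgebra {
  coalg_lmod :> lmodType k;
  comul : {linear coalg_lmod -> coalg_lmod ⊗ coalg_lmod};
  counit : {scalar coalg_lmod};
  coalgP : is_coalgebra comul counit }.
Arguments comul {k c}.
Arguments counit {k c}.

Record hopfAlgebra (k : fieldType) := HopfAlgebra {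
  hopf_alg :> algType k;
  hcomul : {linear hopf_alg -> hopf_alg ⊗ hopf_alg};
  hcounit : {scalar hopf_alg};
  antipode : {linear hopf_alg -> hopf_alg};
  hopf_coalgP : is_coalgebra hcomul hcounit;
  hcomul_morph : monoid_morphism hcomul;
  hcounit_morph : monoid_morphism hcounit;
  antipodel : forall x,
    tmult ((antipode ⊠ lid hopf_alg) (hcomul x)) = (hcounit x)%:A;
  antipoder : forall x,
    tmult ((lid hopf_alg ⊠ antipode) (hcomul x)) = (hcounit x)%:A }.
Arguments hcomul {k h}.
Arguments hcounit {k h}.
Arguments antipode {k} h.

Definition short_exact (U V W : zmodType) (f : U -> V) (g : V -> W) : Prop :=
  [/\ injective f,
      forall v, g v = 0 <-> exists u, f u = v &
      forall w, exists v, g v = w].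

Record rcomodule (k : fieldType) (C : coalgebra k) := RComodule {
  rcomod_lmod :> lmodType k;
  rcoact : {linear rcomod_lmod -> rcomod_lmod ⊗ C};
  rcoact_assoc : forall m,
    tassoc ((rcoact ⊠ lid C) (rcoact m)) = (lid rcomod_lmod ⊠ comul) (rcoact m);
  rcoact_unit : forall m, tcontr counit (rcoact m) = m }.
Arguments rcoact {k C} r.

Record lcomodule (k : fieldType) (C : coalgebra k) := LComodule {
  lcomod_lmod :> lmodType k;
  lcoact : {linear lcomod_lmod -> C ⊗ lcomod_lmod};
  lcoact_assoc : forall m,
    tassoc ((comul ⊠ lid lcomod_lmod) (lcoact m)) = (lid C ⊠ lcoact) (lcoact m);
  lcoact_unit : forall m, tcontl counit (lcoact m) = m }.
Arguments lcoact {k C} l.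

Record lcomod_hom (k : fieldType) (C : coalgebra k) (U V : lcomodule C) :=
  LComodHom {
    lcomod_fun :> {linear U -> V};
    lcomod_homP : forall u,
      lcoact V (lcomod_fun u) = (lid C ⊠ lcomod_fun) (lcoact U u) }.

Section Cotensor.
Variables (k : fieldType) (C : coalgebra k).

Definition cotens_pred (M : rcomodule C) (N : lcomodule C) : {pred M ⊗ N} :=
  fun x => tassoc ((rcoact M ⊠ lid N) x) == (lid M ⊠ lcoact N) x.

Fact cotens_submod_closed (M : rcomodule C) (N : lcomodule C) :
  submod_closed (@cotens_pred M N).
Proof.
split=> [|a x y /eqP hx /eqP hy]; rewrite unfold_in /cotens_pred.
  by rewrite !linear0.
by rewrite !(tmapD, tmapZ, tassocD, tassocZ) hx hy.
Qed.

HB.instance Definition _ (M : rcomodule C) (N : lcomodule C) :=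
  GRing.isSubmodClosed.Build k (M ⊗ N) (@cotens_pred M N)
    (@cotens_submod_closed M N).

Definition cotens (M : rcomodule C) (N : lcomodule C) : Type :=
  {x : M ⊗ N | x \in @cotens_pred M N}.

Section Instances.
Variables (M : rcomodule C) (N : lcomodule C).
HB.instance Definition _ := [isSub of cotens M N for @sval _ _].
HB.instance Definition _ := [Choice of cotens M N by <:].
HB.instance Definition _ := [SubChoice_isSubLmodule of cotens M N by <:].
End Instances.

Fact cotens_map_subproof (M : rcomodule C) (U V : lcomodule C)
    (f : lcomod_hom U V) (x : cotens M U) :
  (lid M ⊠ f) (val x) \in @cotens_pred M V.
Proof.
rewrite unfold_in /cotens_pred; have /eqP := valP x.
move: (val x) => {}x hx; apply/eqP.
have -> : (rcoact M ⊠ lid V) ((lid M ⊠ f) x) =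
          ((lid M ⊠ lid C) ⊠ f) ((rcoact M ⊠ lid U) x).
  elim/tens_ind: x {hx} => [m u|x y hx hy]; last by rewrite !tmapD hx hy.
  rewrite !tmap_pure; congr (_ ⊗ₜ _) => /=.
  elim/tens_ind: (rcoact M m) => [n c|y z hy hz]; first by rewrite tmap_pure.
  by rewrite tmapD -hy -hz.
rewrite tassoc_tmap hx !tmap_comp; apply: eq_tmap => u //=.
by rewrite lcomod_homP.
Qed.

Definition cotens_map (M : rcomodule C) (U V : lcomodule C)
    (f : lcomod_hom U V) (x : cotens M U) : cotens M V :=
  exist (fun y => y \in @cotens_pred M V) _ (cotens_map_subproof f x).

(** [M] is coflat: the functor [M □_C ?] is exact. *)
Definition coflat (M : rcomodule C) : Prop :=
  forall (U V W : lcomodule C) (f : lcomod_hom U V) (g : lcomod_hom V W),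
    short_exact f g -> short_exact (cotens_map (M := M) f) (cotens_map (M := M) g).

End Cotensor.

(** Right [R]-modules are left modules over the converse ring [R^c]. *)

Definition rtens (R : pzRingType) (M : lmodType R^c) (N : lmodType R) : Type :=
  @bten R M N (fun a m => (a : R^c) *: m) (fun a n => a *: n).

HB.instance Definition _ (R : pzRingType) (M : lmodType R^c) (N : lmodType R) :=
  GRing.Zmodule.on (rtens M N).

Definition rpure (R : pzRingType) (M : lmodType R^c) (N : lmodType R)
  (m : M) (n : N) : rtens M N := bpure _ _ m n.

Definition rtens_map (R : pzRingType) (M : lmodType R^c) (N N' : lmodType R)
    (f : {linear N -> N'}) : rtens M N -> rtens M N' :=
  blift (fun m n => rpure m (f n)).

Fact rtens_map_balanced (R : pzRingType) (M : lmodType R^c) (N N' : lmodType R)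
    (f : {linear N -> N'}) :
  @balanced R M N (fun a m => (a : R^c) *: m) (fun a n => a *: n) (rtens M N')
    (fun m n => rpure m (f n)).
Proof.
have [pDl pDr pM] := bpure_balanced (fun (a : R) (m : M) => (a : R^c) *: m)
  (fun a (n : N') => a *: n).
by split=> *; rewrite /rpure ?linearD ?linearZ ?pDl ?pDr ?pM.
Qed.

(** [M] is flat: the functor [M ⊗_R ?] is exact. *)
Definition right_flat (R : pzRingType) (M : lmodType R^c) : Prop :=
  forall (U V W : lmodType R) (f : {linear U -> V}) (g : {linear V -> W}),
    short_exact f g -> short_exact (rtens_map (M := M) f) (rtens_map (M := M) g).

(** [S] as a right [R]-module through the ring morphism [f : R -> S]. *)
Definition pullback_rmod (R S : pzRingType) (f : {rmorphism R -> S}) : Type := S.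

Section PullbackRmod.
Variables (R S : pzRingType) (f : {rmorphism R -> S}).

HB.instance Definition _ := GRing.Zmodule.copy (pullback_rmod f) S.

Definition pullback_scale (a : R^c) (s : pullback_rmod f) : pullback_rmod f :=
  (s : S) * f a.

Fact pullback_scaleA a b s :
  pullback_scale a (pullback_scale b s) = pullback_scale (a * b) s.
Proof. by rewrite /pullback_scale -mulrA -rmorphM. Qed.

Fact pullback_scale1 : left_id 1 pullback_scale.
Proof. by move=> s; rewrite /pullback_scale rmorph1 mulr1. Qed.

Fact pullback_scaleDr : right_distributive pullback_scale +%R.
Proof. by move=> a s t; rewrite /pullback_scale -mulrDl. Qed.

Fact pullback_scaleDl s : {morph pullback_scale^~ s : a b / a + b}.
Proof. by move=> a b; rewrite /pullback_scale rmorphD mulrDr. Qed.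

HB.instance Definition _ := GRing.Zmodule_isLmodule.Build R^c (pullback_rmod f)
  pullback_scaleA pullback_scale1 pullback_scaleDr pullback_scaleDl.

End PullbackRmod.

Definition ring_epi (R S : pzRingType) (f : {rmorphism R -> S}) : Prop :=
  forall (T : pzRingType) (g h : {rmorphism S -> T}), g \o f =1 h \o f -> g =1 h.

Definition perfect_left_localization (R S : pzRingType)
    (f : {rmorphism R -> S}) : Prop :=
  right_flat (pullback_rmod f) /\ ring_epi f.

Section Subalg.
Variables (k : fieldType) (A : algType k) (S : subalgClosed A).

Definition subalg : Type := {x : A | x \in S}.

HB.instance Definition _ := [isSub of subalg for @sval _ _].
HB.instance Definition _ := [Choice of subalg by <:].
HB.instance Definition _ := [SubChoice_isSubAlgebra of subalg by <:].

Definition subalg_val : {linear subalg -> A} := \val.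
Definition subalg_incl : {rmorphism subalg -> A} := \val.

End Subalg.

Section QuotientSpace.
Variables (k : fieldType) (V : lmodType k) (I : submodClosed V).

(* [submodClosed] does not inherit from [zmodClosed] *)
Definition submod_pred : {pred V} := fun v => v \in I.

Fact submod_pred_zmod_closed : zmod_closed submod_pred.
Proof.
split=> [|u v uI vI]; rewrite unfold_in; first exact: rpred0.
by rewrite rpredD // -scaleN1r rpredZ.
Qed.

HB.instance Definition _ :=
  GRing.isZmodClosed.Build V submod_pred submod_pred_zmod_closed.

Local Notation Q := {ideal_quot submod_pred}.

Definition quotmod : Type := Q.

HB.instance Definition _ := GRing.Zmodule.copy quotmod Q.

Definition quot_pi_fun (v : V) : quotmod := \pi_Q v.
Definition quot_repr (x : quotmod) : V := repr (x : Q).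

Fact quot_piE u v : quot_pi_fun u = quot_pi_fun v <-> u - v \in I.
Proof.
rewrite -[_ \in I]/(_ \in submod_pred) Quotient.idealrBE.
by split=> [uv|/eqP //]; apply/eqP.
Qed.

Fact quot_reprK : cancel quot_repr quot_pi_fun. Proof. exact: reprK. Qed.

Fact quot_pi_zmod_morphism : zmod_morphism quot_pi_fun.
Proof. exact: (raddfB \pi_Q). Qed.

Definition quot_scale (a : k) (x : quotmod) : quotmod :=
  quot_pi_fun (a *: quot_repr x).

Fact quot_scale_pi a v : quot_scale a (quot_pi_fun v) = quot_pi_fun (a *: v).
Proof.
by apply/quot_piE; rewrite -scalerBr rpredZ //; apply/quot_piE/quot_reprK.
Qed.

Fact quot_piD : {morph quot_pi_fun : u v / u + v}.
Proof. exact: zmod_morphismD quot_pi_zmod_morphism. Qed.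

Fact quot_scaleA a b x : quot_scale a (quot_scale b x) = quot_scale (a * b) x.
Proof. by rewrite -[x]quot_reprK !quot_scale_pi scalerA. Qed.

Fact quot_scale1 : left_id 1 quot_scale.
Proof. by move=> x; rewrite -[x]quot_reprK quot_scale_pi scale1r. Qed.

Fact quot_scaleDr : right_distributive quot_scale +%R.
Proof.
move=> a x y; rewrite -[x]quot_reprK -[y]quot_reprK.
by rewrite -quot_piD !quot_scale_pi scalerDr quot_piD.
Qed.

Fact quot_scaleDl x : {morph quot_scale^~ x : a b / a + b}.
Proof.
by move=> a b; rewrite -[x]quot_reprK !quot_scale_pi scalerDl quot_piD.
Qed.

HB.instance Definition _ := GRing.Zmodule_isLmodule.Build k quotmod
  quot_scaleA quot_scale1 quot_scaleDr quot_scaleDl.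

Fact quot_pi_is_linear : linear quot_pi_fun.
Proof. by move=> a u v; rewrite quot_piD -quot_scale_pi. Qed.

HB.instance Definition _ := GRing.isLinear.Build k V quotmod _ quot_pi_fun
  quot_pi_is_linear.

Definition quot_pi : {linear V -> quotmod} := quot_pi_fun.

Lemma quot_ind (P : quotmod -> Prop) :
  (forall v, P (quot_pi v)) -> forall x, P x.
Proof. by move=> Pv x; rewrite -[x]quot_reprK; exact: Pv. Qed.

Lemma quot_pi_eq0 v : v \in I -> quot_pi v = 0.
Proof. by move=> vI; rewrite -(linear0 quot_pi); apply/quot_piE; rewrite subr0. Qed.

Definition quot_lift (W : lmodType k) (f : {linear V -> W}) (x : quotmod) : W :=
  f (quot_repr x).

Section Lift.
Variables (W : lmodType k) (f : {linear V -> W}).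
Hypothesis f0 : forall v, v \in I -> f v = 0.

Lemma quot_lift_pi v : quot_lift f (quot_pi v) = f v.
Proof.
apply/eqP; rewrite -subr_eq0 -linearB; apply/eqP/f0/quot_piE.
exact: quot_reprK.
Qed.

Lemma quot_lift_is_linear : linear (quot_lift f).
Proof.
move=> a; elim/quot_ind => u; elim/quot_ind => v.
by rewrite -linearP !quot_lift_pi linearP.
Qed.

End Lift.

End QuotientSpace.

(** [Δ(A) ⊂ A ⊗ H], where [A ⊗ H] is identified with its image in [H ⊗ H]. *)
Definition right_coideal (k : fieldType) (H : hopfAlgebra k)
    (A : subalgClosed H) : Prop :=
  forall a, a \in A ->
    exists y : subalg A ⊗ H, hcomul a = (subalg_val A ⊠ lid H) y.

Record rcoidSubalgebra (k : fieldType) (H : hopfAlgebra k) := RCoidSubalgebra {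
  rcs_subalg :> subalgClosed H;
  rcsP : right_coideal rcs_subalg }.

Section RCoidSubalgebra.
Variables (k : fieldType) (H : hopfAlgebra k) (A : rcoidSubalgebra H).

(** [A^+] *)
Definition aug : {pred H} := [pred a | (a \in A) && (hcounit a == 0)].

(** The additive subgroup generated by the products [h a] is [H A^+]. *)
Definition Haug_gen (x : H) : Prop := exists h a, a \in aug /\ x = h * a.

Definition Haug : {pred H} := zspan_pred Haug_gen.

Fact Haug_submod_closed : submod_closed Haug.
Proof.
rewrite /Haug; split=> [|c x y /zspanP hx /zspanP hy]; first exact: rpred0.
rewrite rpredD //; last exact/zspanP; apply/zspanP.
elim: hx => [|z [h [a [aA ->]]]|u v _ hu _ hv].
- by rewrite scaler0; exact: zspan0.
- by rewrite scalerAl; apply: zspan_gen; exists (c *: h), a.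
- by rewrite scalerBr; exact: zspanB.
Qed.

HB.instance Definition _ := GRing.isSubmodClosed.Build k H Haug
  Haug_submod_closed.

(** [π : H -> H / H A^+] *)
Definition cpi : {linear H -> quotmod Haug} := quot_pi Haug.

Fact rcs_augB a : a \in A -> a - (hcounit a)%:A \in aug.
Proof.
move=> aA; rewrite inE -scaleNr rpredD ?rpredZ ?rpred1 //=.
have [e1 _] := hcounit_morph H.
by rewrite linearD linearZ /= e1 mulr1 subrr.
Qed.

Fact cpi_mul_aug h a : a \in aug -> cpi (h * a) = 0.
Proof.
move=> aA; apply: quot_pi_eq0; apply/zspanP/zspan_gen; by exists h, a.
Qed.

Fact cpi_mulA h a : a \in A -> cpi (h * a) = hcounit a *: cpi h.
Proof.
move=> aA; apply/eqP; rewrite -subr_eq0 -linearZ -linearB /=; apply/eqP.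
rewrite -(cpi_mul_aug h (rcs_augB aA)) mulrBr; congr (cpi (_ - _)).
by rewrite -scalerAr mulr1.
Qed.

(** [(π ⊗ g)(z (a ⊗ h)) = (π ⊗ g)(z (1 ⊗ ε(a) h))] *)
Fact cpi_tmap_mul (W : lmodType k) (g : {linear H -> W}) (z : H ⊗ H)
    (y : subalg A ⊗ H) :
  (cpi ⊠ g) (z * (subalg_val A ⊠ lid H) y) =
  (cpi ⊠ g) (z * (1 ⊗ₜ tcontl hcounit ((subalg_val A ⊠ lid H) y))).
Proof.
elim/tens_ind: y => [a h|x y hx hy]; last first.
  by rewrite tmapD mulrDr tmapD hx hy -tmapD -mulrDr -pureDr -tcontlD.
rewrite tmap_pure /= tcontl_pure.
elim/tens_ind: z => [u v|x y hx hy]; last by rewrite !mulrDl !tmapD hx hy.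
rewrite !pureM !tmap_pure mulr1 cpi_mulA; last exact: valP.
by rewrite -scalerAr linearZ pureZl pureZr.
Qed.

Fact cpi_comul_mul (W : lmodType k) (g : {linear H -> W}) (z : H ⊗ H) a :
  a \in A -> (cpi ⊠ g) (z * hcomul a) = (cpi ⊠ g) (z * (1 ⊗ₜ a)).
Proof.
move=> /(rcsP (r := A)) [y ay]; rewrite ay cpi_tmap_mul -ay.
by rewrite (coalg_unitl (hopf_coalgP H)).
Qed.

Fact ccomul_ker x : x \in Haug -> ((cpi ⊠ cpi) \o hcomul)%FUN x = 0.
Proof.
apply: (zspan_ker (f := ((cpi ⊠ cpi) \o hcomul)%FUN)).
move=> _ [h [a [/andP[aA ea] ->]]] /=.
have [_ ->] := hcomul_morph H; rewrite cpi_comul_mul //.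
elim/tens_ind: (hcomul h) => [u v|y z hy hz].
  rewrite pureM tmap_pure [cpi (v * a)]cpi_mul_aug ?inE ?aA //.
  by rewrite -(scale0r 0) pureZr scale0r.
by rewrite mulrDl tmapD hy hz addr0.
Qed.

Fact ccounit_ker x : x \in Haug -> hcounit x = 0.
Proof.
apply: (zspan_ker (f := hcounit)) => _ [h [a [/andP[_ /eqP ea] ->]]].
by rewrite /=; have [_ ->] := hcounit_morph H; rewrite ea mulr0.
Qed.

Definition ccomul_fun : quotmod Haug -> quotmod Haug ⊗ quotmod Haug :=
  quot_lift ((cpi ⊠ cpi) \o hcomul)%FUN.

HB.instance Definition _ := GRing.isLinear.Build k _ _ _ ccomul_fun
  (quot_lift_is_linear ccomul_ker).

Definition ccounit_fun : quotmod Haug -> k := @quot_lift k H Haug k^o hcounit.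

HB.instance Definition _ := GRing.isLinear.Build k (quotmod Haug) k *%R
  ccounit_fun (@quot_lift_is_linear k H Haug k^o hcounit ccounit_ker).

Definition ccomul : {linear quotmod Haug -> quotmod Haug ⊗ quotmod Haug} :=
  ccomul_fun.
Definition ccounit : {scalar quotmod Haug} := ccounit_fun.

Lemma ccomul_pi h : ccomul (cpi h) = (cpi ⊠ cpi) (hcomul h).
Proof. exact: (quot_lift_pi ccomul_ker). Qed.

Lemma ccounit_pi h : ccounit (cpi h) = hcounit h.
Proof. exact: (@quot_lift_pi k H Haug k^o hcounit ccounit_ker). Qed.

Fact quot_is_coalgebra : is_coalgebra ccomul ccounit.
Proof.
have [HA Hl Hr] := hopf_coalgP H.
split; elim/quot_ind => h; rewrite -/cpi ccomul_pi.
- rewrite !tmap_comp.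
  rewrite (@eq_tmap _ _ _ _ _ (ccomul \o cpi)%FUN ((cpi ⊠ cpi) \o hcomul)%FUN
    (lid _ \o cpi)%FUN (cpi \o lid H)%FUN ccomul_pi (frefl _)).
  rewrite (@eq_tmap _ _ _ _ _ (lid _ \o cpi)%FUN (cpi \o lid H)%FUN
    (ccomul \o cpi)%FUN ((cpi ⊠ cpi) \o hcomul)%FUN (frefl _) ccomul_pi).
  by rewrite -!tmap_comp tassoc_tmap HA.
- rewrite -[in RHS](Hl h); elim/tens_ind: (hcomul h) => [u v|x y hx hy].
    by rewrite tmap_pure !tcontl_pure ccounit_pi linearZ.
  by rewrite tmapD !(tcontlD, tcontrD) hx hy linearD.
- rewrite -[in RHS](Hr h); elim/tens_ind: (hcomul h) => [u v|x y hx hy].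
    by rewrite tmap_pure !tcontr_pure ccounit_pi linearZ.
  by rewrite tmapD !(tcontlD, tcontrD) hx hy linearD.
Qed.

Definition quot_coalgebra : coalgebra k := Coalgebra quot_is_coalgebra.

(** [H] as a right [C]-comodule through [(id ⊗ π) Δ]. *)
Definition hcoact : {linear H -> H ⊗ quot_coalgebra} :=
  ((lid H ⊠ cpi) \o hcomul)%FUN.

Fact hcoact_assoc h :
  tassoc ((hcoact ⊠ lid quot_coalgebra) (hcoact h)) =
  (lid H ⊠ comul) (hcoact h).
Proof.
have [HA _ _] := hopf_coalgP H; rewrite /hcoact /= !tmap_comp.
rewrite (@eq_tmap _ _ _ _ _ (hcoact \o lid H)%FUN
  ((lid H ⊠ cpi) \o hcomul)%FUN (lid quot_coalgebra \o cpi)%FUN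
  (cpi \o lid H)%FUN (frefl _) (frefl _)).
rewrite (@eq_tmap _ _ _ _ _ (lid H \o lid H)%FUN (lid H \o lid H)%FUN
  (ccomul \o cpi)%FUN ((cpi ⊠ cpi) \o hcomul)%FUN (frefl _) ccomul_pi).
by rewrite -!tmap_comp tassoc_tmap HA.
Qed.

Fact hcoact_unit h : tcontr counit (hcoact h) = h.
Proof.
have [_ _ Hr] := hopf_coalgP H; rewrite -[in RHS](Hr h) /=.
elim/tens_ind: (hcomul h) => [u v|x y hx hy].
  by rewrite tmap_pure !tcontr_pure ccounit_pi.
by rewrite tmapD !(tcontlD, tcontrD) hx hy.
Qed.

Definition hopf_rcomodule : rcomodule quot_coalgebra :=
  RComodule hcoact_assoc hcoact_unit.

(** The algebra [A' = {}^{co C} H]. *)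
Definition coinv : {pred H} := fun h => (cpi ⊠ lid H) (hcomul h) == cpi 1 ⊗ₜ h.

Lemma coinvP h :
  reflect ((cpi ⊠ lid H) (hcomul h) = cpi 1 ⊗ₜ h) (h \in coinv).
Proof. exact: eqP. Qed.

Definition hlmul_fun (h x : H) : H := h * x.

Fact hlmul_is_linear h : linear (hlmul_fun h).
Proof. by move=> a x y; rewrite /hlmul_fun mulrDr scalerAr. Qed.

HB.instance Definition _ h :=
  GRing.isLinear.Build k H H _ (hlmul_fun h) (hlmul_is_linear h).

Definition hlmul (h : H) : {linear H -> H} := hlmul_fun h.

Definition hrmul_fun (h x : H) : H := x * h.

Fact hrmul_is_linear h : linear (hrmul_fun h).
Proof. by move=> a x y; rewrite /hrmul_fun mulrDl scalerAl. Qed.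

HB.instance Definition _ h :=
  GRing.isLinear.Build k H H _ (hrmul_fun h) (hrmul_is_linear h).

Definition hrmul (h : H) : {linear H -> H} := hrmul_fun h.

Fact clmul_ker h x : x \in Haug -> (cpi \o hlmul h)%FUN x = 0.
Proof.
apply: (zspan_ker (f := (cpi \o hlmul h)%FUN)) => _ [h' [a [aA ->]]] /=.
by rewrite /hlmul_fun mulrA cpi_mul_aug.
Qed.

Definition clmul_fun (h : H) : quotmod Haug -> quotmod Haug :=
  quot_lift (cpi \o hlmul h)%FUN.

HB.instance Definition _ h := GRing.isLinear.Build k _ _ _ (clmul_fun h)
  (quot_lift_is_linear (clmul_ker h)).

(** The left [H]-module structure of [C = H / H A^+]. *)
Definition clmul (h : H) : {linear quotmod Haug -> quotmod Haug} := clmul_fun h.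

Lemma clmul_pi h x : clmul h (cpi x) = cpi (h * x).
Proof. exact: (quot_lift_pi (clmul_ker h)). Qed.

Fact cpi_lid_mull (z u u' : H ⊗ H) :
  (cpi ⊠ lid H) u = (cpi ⊠ lid H) u' ->
  (cpi ⊠ lid H) (z * u) = (cpi ⊠ lid H) (z * u').
Proof.
move=> uu'; elim/tens_ind: z => [v w|x y hx hy]; last first.
  by rewrite !mulrDl !tmapD hx hy.
have mE t : (cpi ⊠ lid H) ((v ⊗ₜ w) * t) = (clmul v ⊠ hlmul w) ((cpi ⊠ lid H) t).
  elim/tens_ind: t => [a b|x y hx hy]; last by rewrite mulrDr !tmapD hx hy.
  by rewrite pureM !tmap_pure clmul_pi.
by rewrite !mE uu'.
Qed.

Fact coinv_subalg_closed : subalg_closed coinv.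
Proof.
have [D1 DM] := hcomul_morph H; split=> [|a x y /coinvP hx /coinvP hy|x y].
- by apply/coinvP; rewrite D1 pure1 tmap_pure.
- by apply/coinvP; rewrite linearP tmapD tmapZ hx hy pureDr pureZr.
move=> /coinvP hx /coinvP hy; apply/coinvP; rewrite DM.
rewrite (@cpi_lid_mull _ _ (1 ⊗ₜ y)); last by rewrite hy tmap_pure.
have mE t : (cpi ⊠ lid H) (t * (1 ⊗ₜ y)) =
    (lid _ ⊠ hrmul y) ((cpi ⊠ lid H) t).
  elim/tens_ind: t => [a b|u v hu hv]; last by rewrite mulrDl !tmapD hu hv.
  by rewrite pureM !tmap_pure mulr1.
by rewrite mE hx tmap_pure.
Qed.

HB.instance Definition _ := GRing.isSubalgClosed.Build k H coinv
  (GRing.subalg_closed_semi coinv_subalg_closed).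

Fact rcs_sub_coinv a : a \in A -> a \in coinv.
Proof.
move=> aA; apply/coinvP; rewrite -[hcomul a]mul1r cpi_comul_mul //.
by rewrite mul1r tmap_pure.
Qed.

Definition coinv_incl_fun (a : subalg A) : subalg coinv :=
  exist (fun h => h \in coinv) (val a) (rcs_sub_coinv (valP a)).

Fact coinv_incl_is_zmod_morphism : zmod_morphism coinv_incl_fun.
Proof.
move=> a b; apply: val_inj; rewrite [RHS]raddfB.
exact: (raddfB (subalg_val A)).
Qed.

Fact coinv_incl_is_monoid_morphism : monoid_morphism coinv_incl_fun.
Proof.
split=> [|a b]; apply: val_inj; first by rewrite rmorph1.
by rewrite [RHS]rmorphM.
Qed.

HB.instance Definition _ := GRing.isZmodMorphism.Build (subalg A) (subalg coinv)
  coinv_incl_fun coinv_incl_is_zmod_morphism.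
HB.instance Definition _ := GRing.isMonoidMorphism.Build (subalg A)
  (subalg coinv) coinv_incl_fun coinv_incl_is_monoid_morphism.

Definition coinv_incl : {rmorphism subalg A -> subalg coinv} := coinv_incl_fun.

End RCoidSubalgebra.

(* Main.v *)
(** For a left [A]-module [U], the induced module [H ⊗_A U] is a left
    [C]-comodule through [h ⊗ u ↦ π(h₁) ⊗ h₂ ⊗ u], and
    [x ⊗ v ↦ S(x) v], restricted to [H □_C (H ⊗_A U)], retracts the cotensor
    product onto the coinvariants of [H ⊗_A U].  Hence flatness of [H] over [A]
    and coflatness of [H] over [C] make [U ↦ {}^{co C}(H ⊗_A U)] exact.  On a
    free module [A^(X)] its value is [A'^(X)], so a free presentation of [U]
    shows, as in the Eilenberg-Watts theorem, that [A' ⊗_A U -> H ⊗_A U] is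
    injective with the coinvariants as image; in particular [A'] is flat.
    Finally [H ⊗_A H -> C ⊗ H, x ⊗ y ↦ π(x₁) ⊗ x₂ y] is injective and takes
    the same value on [x ⊗ 1] and [1 ⊗ x] if [x] is in [A'].  As
    [A' ⊗_A A' -> H ⊗_A A' -> H ⊗_A H] is injective, [x ⊗ 1 = 1 ⊗ x] holds in
    [A' ⊗_A A'], which means that [A -> A'] is an epimorphism. *)

From HB Require Import structures.
Require Import Defs.
From mathcomp Require Import all_boot all_algebra.
From mathcomp Require Import boolp.
From mathcomp Require Import freeg.

Set Implicit Arguments.
Unset Strict Implicit.
Unset Printing Implicit Defensive.

Import GRing.Theory.

Local Open Scope ring_scope.
Local Open Scope quotient_scope.

(** * Modules over a noncommutative ring *)

Section Kernel.
Variables (R : pzRingType) (U V : lmodType R) (f : {linear U -> V}).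

Definition ker_pred : {pred U} := fun u => f u == 0.

Fact ker_submod_closed : submod_closed ker_pred.
Proof.
split=> [|a u v /eqP fu /eqP fv]; rewrite unfold_in /ker_pred ?linear0 //.
by rewrite linearP fu fv scaler0 addr0.
Qed.

HB.instance Definition _ :=
  GRing.isSubmodClosed.Build R U ker_pred ker_submod_closed.

Definition ker : Type := {u : U | u \in ker_pred}.
HB.instance Definition _ := [isSub of ker for @sval _ _].
HB.instance Definition _ := [Choice of ker by <:].
HB.instance Definition _ := [SubChoice_isSubLmodule of ker by <:].

Definition ker_val : {linear ker -> U} := \val.

Lemma ker_short_exact :
  (forall v, exists u, f u = v) -> short_exact ker_val f.
Proof.
split=> //; first exact: val_inj.
move=> u; split=> [/eqP fu|[v <-]]; last exact/eqP/(valP v).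
by exists (exist (fun u => u \in ker_pred) u fu).
Qed.

End Kernel.

Section Cokernel.
Variables (R : pzRingType) (U V : lmodType R) (f : {linear U -> V}).

Definition im_pred : {pred V} := fun v => `[< exists u, f u = v >].

Fact im_zmod_closed : zmod_closed im_pred.
Proof.
split=> [|v w /asboolP[u <-] /asboolP[u' <-]]; apply/asboolP.
  by exists 0; rewrite linear0.
by exists (u - u'); rewrite linearB.
Qed.

HB.instance Definition _ :=
  GRing.isZmodClosed.Build V im_pred im_zmod_closed.

Local Notation Q := {ideal_quot im_pred}.

Definition coker : Type := Q.

HB.instance Definition _ := GRing.Zmodule.copy coker Q.

Definition coker_pi_fun (v : V) : coker := \pi_Q v.
Definition coker_repr (x : coker) : V := repr (x : Q).

Fact coker_piE u v : coker_pi_fun u = coker_pi_fun v <-> u - v \in im_pred.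
Proof. by rewrite Quotient.idealrBE; split=> [uv|/eqP //]; apply/eqP. Qed.

Fact coker_reprK : cancel coker_repr coker_pi_fun. Proof. exact: reprK. Qed.

Fact coker_piD : {morph coker_pi_fun : u v / u + v}.
Proof. exact: zmod_morphismD (raddfB \pi_Q). Qed.

(** The quotient by [im_pred] is only an additive group, so scalars act through representatives. The
    choice does not matter because the image is stable under scaling, see [coker_scale_pi]. *)
Definition coker_scale (a : R) (x : coker) : coker :=
  coker_pi_fun (a *: coker_repr x).

Fact coker_scale_pi a v :
  coker_scale a (coker_pi_fun v) = coker_pi_fun (a *: v).
Proof.
apply/coker_piE; rewrite -scalerBr.
have /asboolP[u fu] : coker_repr (coker_pi_fun v) - v \in im_pred.
  exact/coker_piE/coker_reprK.
by apply/asboolP; exists (a *: u); rewrite linearZ /= fu.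
Qed.

Fact coker_scaleA a b x :
  coker_scale a (coker_scale b x) = coker_scale (a * b) x.
Proof. by rewrite -[x]coker_reprK !coker_scale_pi scalerA. Qed.

Fact coker_scale1 : left_id 1 coker_scale.
Proof. by move=> x; rewrite -[x]coker_reprK coker_scale_pi scale1r. Qed.

Fact coker_scaleDr : right_distributive coker_scale +%R.
Proof.
move=> a x y; rewrite -[x]coker_reprK -[y]coker_reprK.
by rewrite -coker_piD !coker_scale_pi scalerDr coker_piD.
Qed.

Fact coker_scaleDl x : {morph coker_scale^~ x : a b / a + b}.
Proof.
by move=> a b; rewrite -[x]coker_reprK !coker_scale_pi scalerDl coker_piD.
Qed.

HB.instance Definition _ := GRing.Zmodule_isLmodule.Build R coker
  coker_scaleA coker_scale1 coker_scaleDr coker_scaleDl.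

Fact coker_pi_is_linear : linear coker_pi_fun.
Proof. by move=> a u v; rewrite coker_piD -coker_scale_pi. Qed.

HB.instance Definition _ := GRing.isLinear.Build R V coker _ coker_pi_fun
  coker_pi_is_linear.

Definition coker_pi : {linear V -> coker} := coker_pi_fun.

Lemma coker_short_exact : injective f -> short_exact f coker_pi.
Proof.
split=> // [v|x]; last by exists (coker_repr x); exact: coker_reprK.
have -> : coker_pi v = 0 <-> v \in im_pred.
  by rewrite -[v in X in _ <-> X]subr0 -coker_piE -(linear0 coker_pi).
by split=> [/asboolP|] // fv; apply/asboolP.
Qed.

End Cokernel.

(** * Tensor products over a noncommutative ring *)

Section RTens.
Variables (R : pzRingType) (M : lmodType R^c) (N : lmodType R).

Lemma rpureDl m m' (n : N) : rpure (m + m') n = rpure m n + rpure m' n :> rtens M N.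
Proof. exact: (balDl (bpure_balanced _ _)). Qed.

Lemma rpureDr (m : M) (n n' : N) : rpure m (n + n') = rpure m n + rpure m n'.
Proof. exact: (balDr (bpure_balanced _ _)). Qed.

Lemma rpureM (a : R) (m : M) (n : N) :
  rpure ((a : R^c) *: m) n = rpure m (a *: n).
Proof. exact: (balM (bpure_balanced (fun (a : R) (m : M) => (a : R^c) *: m) _)). Qed.

Lemma rtens_ind (P : rtens M N -> Prop) :
  (forall m n, P (rpure m n)) -> (forall x y, P x -> P y -> P (x + y)) ->
  forall x, P x.
Proof. exact: bten_ind. Qed.

Definition rbalanced (G : zmodType) (f : M -> N -> G) : Prop :=
  balanced (fun (a : R) (m : M) => (a : R^c) *: m) (fun a n => a *: n) f.

Definition rlift (G : zmodType) (f : M -> N -> G) : rtens M N -> G := blift f.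

Lemma rlift_pure (G : zmodType) (f : M -> N -> G) m n :
  rbalanced f -> rlift f (rpure m n) = f m n.
Proof. by move=> fB; exact: (blift_pure fB). Qed.

Lemma rliftD (G : zmodType) (f : M -> N -> G) :
  rbalanced f -> {morph rlift f : x y / x + y}.
Proof. by move=> fB; exact: zmod_morphismD (blift_is_zmod_morphism fB). Qed.

Lemma rpure0l (n : N) : rpure (0 : M) n = 0.
Proof. by apply: (addIr (rpure (0 : M) n)); rewrite -rpureDl !add0r. Qed.

Lemma rpure0r (m : M) : rpure m (0 : N) = 0.
Proof. by apply: (addIr (rpure m (0 : N))); rewrite -rpureDr !add0r. Qed.

Lemma rpure_sumr (m : M) (I : Type) (s : seq I) (F : I -> N) :
  rpure m (\sum_(i <- s) F i) = \sum_(i <- s) rpure m (F i).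
Proof. exact: (big_morph _ (rpureDr m) (rpure0r m)). Qed.

End RTens.

Section RTensMap.
Variables (R : pzRingType) (M : lmodType R^c) (N N' : lmodType R).
Variable f : {linear N -> N'}.

Lemma rtens_map_pure (m : M) n : rtens_map f (rpure m n) = rpure m (f n).
Proof. exact: (blift_pure (rtens_map_balanced M f)). Qed.

HB.instance Definition _ := GRing.isZmodMorphism.Build (rtens M N) (rtens M N')
  (rtens_map (M := M) f) (blift_is_zmod_morphism (rtens_map_balanced M f)).

Lemma rtens_mapD : {morph @rtens_map R M N N' f : x y / x + y}.
Proof. exact: raddfD. Qed.

(** Flatness is stated for short exact sequences, so [f] is completed to one by the projection onto
    its cokernel. *)
Lemma right_flat_injective :
  right_flat M -> injective f -> injective (rtens_map (M := M) f).
Proof. by move=> Mflat /coker_short_exact /Mflat[]. Qed.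

Lemma rtens_map_surj : (forall n', exists n, f n = n') ->
  forall y, exists x, rtens_map (M := M) f x = y.
Proof.
move=> fs; elim/rtens_ind => [m n'|y y' [x <-] [x' <-]].
  by have [n <-] := fs n'; exists (rpure m n); rewrite rtens_map_pure.
by exists (x + x'); rewrite rtens_mapD.
Qed.

End RTensMap.

Section RTensMapl.
Variables (R : pzRingType) (M M' : lmodType R^c) (N : lmodType R).
Variable f : {linear M -> M'}.

Definition rtens_mapl : rtens M N -> rtens M' N :=
  rlift (fun m n => rpure (f m) n).

Fact rtens_mapl_balanced : rbalanced (fun m (n : N) => rpure (f m) n).
Proof. by split=> *; rewrite ?linearD ?linearZ ?rpureDl ?rpureDr ?rpureM. Qed.

HB.instance Definition _ := GRing.isZmodMorphism.Build (rtens M N) (rtens M' N)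
  rtens_mapl (blift_is_zmod_morphism rtens_mapl_balanced).

Lemma rtens_mapl_pure m n : rtens_mapl (rpure m n) = rpure (f m) n.
Proof. exact: rlift_pure rtens_mapl_balanced. Qed.

Lemma rtens_maplD : {morph rtens_mapl : x y / x + y}.
Proof. exact: raddfD. Qed.

End RTensMapl.

Lemma rtens_mapl_map (R : pzRingType) (M M' : lmodType R^c) (N N' : lmodType R)
    (f : {linear M -> M'}) (g : {linear N -> N'}) x :
  rtens_mapl f (rtens_map g x) = rtens_map g (rtens_mapl f x).
Proof.
elim/rtens_ind: x => [m n|x y hx hy].
  by rewrite !(rtens_map_pure, rtens_mapl_pure).
by rewrite !(rtens_mapD, rtens_maplD) hx hy.
Qed.

(** * Free modules and their tensor products *)

Section FreeModule.
Variables (R : nzRingType) (X : choiceType).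
Local Notation F := {freeg X / R}.

Section Lift.
Variables (U : lmodType R) (f : X -> U).

Fact fglift_is_linear : linear (fglift f).
Proof.
have fD := zmod_morphismD (lift_is_additive f).
have f0 : fglift f 0 = 0 by apply: (addIr (fglift f 0)); rewrite -fD !add0r.
move=> a D E; rewrite fD; congr (_ + _).
rewrite -[D in RHS]freeg_sumE.
(* Scaling in [freeg] unfolds to this sum of rescaled generators, so both sides become sums over
   [dom D]. *)
rewrite -[a *: D]/(\sum_(x <- dom D) << a * coeff x D *g x >>).
rewrite !(big_morph _ fD f0) scaler_sumr; apply: eq_bigr => x _.
by rewrite !liftU scalerA.
Qed.

HB.instance Definition _ := GRing.isLinear.Build R F U _ (fglift f)
  fglift_is_linear.

Definition freeg_lift : {linear F -> U} := fglift f.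

Lemma freeg_lift_gen x : freeg_lift << x >> = f x.
Proof. by rewrite /= liftU scale1r. Qed.

End Lift.

Variable M : lmodType R^c.

(** The component at [x] of the isomorphism between [M ⊗_R R^(X)] and [M^(X)]. *)
Definition rtens_coef (x : X) : rtens M F -> M :=
  rlift (fun m (D : F) => ((coeff x D : R) : R^c) *: m).

Fact rtens_coef_balanced x :
  rbalanced (fun (m : M) (D : F) => ((coeff x D : R) : R^c) *: m).
Proof.
split=> [m m' D|m D D'|a m D]; first by rewrite scalerDr.
  by rewrite coeffD scalerDl.
by rewrite coeffZ scalerA.
Qed.

HB.instance Definition _ x := GRing.isZmodMorphism.Build (rtens M F) M
  (rtens_coef x) (blift_is_zmod_morphism (rtens_coef_balanced x)).

Lemma rtens_coef_pure x m D : rtens_coef x (rpure m D) = ((coeff x D : R) : R^c) *: m.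
Proof. exact: rlift_pure (rtens_coef_balanced x). Qed.

Lemma rtens_coefD x : {morph rtens_coef x : y z / y + z}.
Proof. exact: raddfD. Qed.

Lemma rtens_coef_sum z :
  exists s, z = \sum_(x <- s) rpure (rtens_coef x z) << x >>.
Proof.
(* The claim is strengthened to all duplicate-free lists containing [s], so that the expansions of
   two summands can be taken over one common list. *)
suff [s sz] : exists s : seq X, forall s', uniq s' -> {subset s <= s'} ->
    z = \sum_(x <- s') rpure (rtens_coef x z) << x >>.
  exists (undup s); apply: (sz (undup s) (undup_uniq s)) => x.
  by rewrite mem_undup.
elim/rtens_ind: z => [m D|y z [s hs] [t ht]]; last first.
  exists (s ++ t) => r rU st.
  have sr : {subset s <= r} by move=> x xs; apply: st; rewrite mem_cat xs.
  have tr : {subset t <= r} by move=> x xt; apply: st; rewrite mem_cat xt orbT.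
  rewrite {1}(hs r rU sr) {1}(ht r rU tr) -big_split /=.
  by apply: eq_bigr => x _; rewrite rtens_coefD rpureDl.
exists (dom D) => s sU Ds.
have DE : D = \sum_(x <- s) coeff x D *: << x >>.
  apply/eqP/freeg_eqP => y; rewrite raddf_sum /=.
  have cE x : coeff y (coeff x D *: << x >>) = coeff x D * (x == y)%:R.
    by rewrite coeffZ coeffU mul1r.
  under eq_bigr do rewrite cE.
  have [ys|ys] := boolP (y \in s).
    rewrite (bigD1_seq y) //= eqxx mulr1 big1 ?addr0 // => x /negPf ->.
    by rewrite mulr0.
  rewrite big_seq big1 => [|x xs]; last first.
    by case: eqP => [xy|_]; rewrite ?mulr0 //; rewrite xy (negPf ys) in xs.
  by rewrite coeff_outdom //; apply: contra ys; exact: Ds.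
rewrite {1}DE rpure_sumr; apply: eq_bigr => x _.
by rewrite rtens_coef_pure rpureM.
Qed.

End FreeModule.

(** * Antipode identities *)

(** The congruence that allows rewriting inside a Sweedler sum: [tlift f (hcomul x)] encodes
    [f x₁ x₂]. *)
Lemma eq_tlift (k : fieldType) (U V W : lmodType k) (f g : U -> V -> W) :
  f =2 g -> tlift f =1 tlift g.
Proof. by move=> fg x; congr tlift; apply/funext => u; exact/funext/fg. Qed.

Lemma linear_tlift (k : fieldType) (U V W W' : lmodType k) (f : U -> V -> W)
    (L : {linear W -> W'}) x :
  bilin f -> L (tlift f x) = tlift (fun u v => L (f u v)) x.
Proof.
move=> fB; have LB : bilin (fun u v => L (f u v)).
  by case: fB => *; split=> *; rewrite -?linearD -?linearZ; congr (L _).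
elim/tens_ind: x => [u v|x y hx hy]; first by rewrite !tlift_pure.
by rewrite !tliftD // linearD hx hy.
Qed.

(** The bundled form that [bilin_comp] accepts when one Sweedler sum is nested in another. *)
Definition linear_of_tlift (k : fieldType) (U V W : lmodType k)
    (f : U -> V -> W) (fB : bilin f) : {linear U ⊗ V -> W} :=
  HB.pack_for {linear U ⊗ V -> W} (tlift f)
    (GRing.isLinear.Build k (U ⊗ V) W _ (tlift f) (tlift_is_linear fB)).

Lemma bilin_comp (k : fieldType) (U U' V V' W : lmodType k) (f : U -> V -> W)
    (L : {linear U' -> U}) (M : {linear V' -> V}) :
  bilin f -> bilin (fun u v => f (L u) (M v)).
Proof.
case=> fDl fDr fZl fZr; split=> [u u' v|u v v'|c u v|c u v].
- by rewrite linearD fDl.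
- by rewrite linearD fDr.
- by rewrite linearZ fZl.
- by rewrite linearZ fZr.
Qed.

Section PureLinear.
Variables (k : fieldType) (V W : lmodType k).

Definition purer (v : V) (w : W) : V ⊗ W := v ⊗ₜ w.
Definition purel (w : W) (v : V) : V ⊗ W := v ⊗ₜ w.

Fact purer_is_linear v : linear (purer v).
Proof. by move=> a w w'; rewrite /purer pureDr pureZr. Qed.

Fact purel_is_linear w : linear (purel w).
Proof. by move=> a v v'; rewrite /purel pureDl pureZl. Qed.

HB.instance Definition _ v := GRing.isLinear.Build k W (tens V W) _ (purer v)
  (purer_is_linear v).
HB.instance Definition _ w := GRing.isLinear.Build k V (tens V W) _ (purel w)
  (purel_is_linear w).

End PureLinear.

Section TensMul.
Variables (k : fieldType) (A B : algType k).

Lemma tens_mulZl c (x y : A ⊗ B) : (c *: x) * y = c *: (x * y).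
Proof.
elim/tens_ind: x => [a b|x x' hx hx']; last first.
  by rewrite scalerDr !mulrDl hx hx' scalerDr.
elim/tens_ind: y => [a' b'|y y' hy hy']; last by rewrite !mulrDr hy hy' scalerDr.
by rewrite -pureZl !pureM -scalerAl pureZl.
Qed.

Lemma tens_mulZr c (x y : A ⊗ B) : x * (c *: y) = c *: (x * y).
Proof.
elim/tens_ind: x => [a b|x x' hx hx']; last by rewrite !mulrDl hx hx' scalerDr.
elim/tens_ind: y => [a' b'|y y' hy hy']; last first.
  by rewrite scalerDr !mulrDr hy hy' scalerDr.
by rewrite -pureZl !pureM -scalerAr pureZl.
Qed.

Lemma tens_mulr_bilin : bilin ( *%R : A ⊗ B -> A ⊗ B -> A ⊗ B).
Proof.
split; [exact: mulrDl | exact: mulrDr | exact: tens_mulZl | exact: tens_mulZr].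
Qed.

End TensMul.

Section Antipode.
Variables (k : fieldType) (H : hopfAlgebra k).

Lemma hcomulM (x y : H) : hcomul (x * y) = hcomul x * hcomul y.
Proof. by have [_ ->] := hcomul_morph H. Qed.

Lemma hcomul1 : hcomul (1 : H) = 1 ⊗ₜ 1.
Proof. by have [->] := hcomul_morph H. Qed.

Lemma hcounitM (x y : H) : hcounit (x * y) = hcounit x * hcounit y.
Proof. by have [_ ->] := hcounit_morph H. Qed.

Lemma hcounit1 : hcounit (1 : H) = 1.
Proof. by have [->] := hcounit_morph H. Qed.

Lemma hcomulA (x : H) :
  tassoc ((hcomul ⊠ lid H) (hcomul x)) = (lid H ⊠ hcomul) (hcomul x).
Proof. exact: coalg_assoc (hopf_coalgP H) x. Qed.

Lemma antipode1 : antipode H 1 = 1.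
Proof.
have := antipodel (1 : H).
by rewrite hcomul1 tmap_pure tmult_pure mulr1 hcounit1 scale1r.
Qed.

(** A linear map on [H ⊗ H ⊗ H] sends [(x₁ ⊗ x₂) ⊗ x₃] and [x₁ ⊗ (x₂ ⊗ x₃)]
    to the same value; [F] and [G] are its two bracketings. *)
Lemma comul3 (W : lmodType k) (F : H ⊗ H -> H -> W) (G : H -> H ⊗ H -> W) x :
  bilin F -> bilin G ->
  (forall a b c, F (a ⊗ₜ b) c = G a (b ⊗ₜ c)) ->
  tlift (fun a c => F (hcomul a) c) (hcomul x) =
  tlift (fun a c => G a (hcomul c)) (hcomul x).
Proof.
move=> FB GB FG.
have FB' := bilin_comp hcomul (lid H) FB.
have GB' := bilin_comp (lid H) hcomul GB.
have FE z : tlift F ((hcomul ⊠ lid H) z) = tlift (fun a c => F (hcomul a) c) z.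
  elim/tens_ind: z => [a c|y z hy hz]; last first.
    by rewrite tmapD !tliftD // hy hz.
  by rewrite tmap_pure !tlift_pure.
have GE z : tlift G ((lid H ⊠ hcomul) z) = tlift (fun a c => G a (hcomul c)) z.
  elim/tens_ind: z => [a c|y z hy hz]; last first.
    by rewrite tmapD !tliftD // hy hz.
  by rewrite tmap_pure !tlift_pure.
rewrite -FE -GE -hcomulA; move: ((hcomul ⊠ lid H) _).
elim/tens_ind => [u c|y z hy hz]; last by rewrite tassocD !tliftD // hy hz.
elim/tens_ind: u => [a b|y z hy hz]; last first.
  by rewrite pureDl tassocD !tliftD // hy hz.
by rewrite tassoc_pure !tlift_pure.
Qed.

Lemma hcounitl (x : H) : tlift (fun a b : H => hcounit a *: b) (hcomul x) = x.
Proof. exact: coalg_unitl (hopf_coalgP H) x. Qed.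

Lemma hcounitr (x : H) : tlift (fun a b : H => hcounit b *: a) (hcomul x) = x.
Proof. exact: coalg_unitr (hopf_coalgP H) x. Qed.

(** After regrouping, the left side is [x₁ ⊗ x₂ S(x₃)], and the antipode axiom followed by the
    counit axiom contracts it. *)
Lemma comul_antipode_contract (x : H) :
  tlift (fun b c => hcomul b * (1 ⊗ₜ antipode H c)) (hcomul x) = x ⊗ₜ 1.
Proof.
rewrite (@comul3 _ (fun u c => u * (1 ⊗ₜ antipode H c))
  (fun a v => a ⊗ₜ tmult ((lid H ⊠ antipode H) v))).
- under eq_tlift => a c do rewrite antipoder pureZr -pureZl.
  rewrite -[x in RHS]hcounitr -/(purel 1 (tlift _ _)) linear_tlift //.
  exact: tcontr_bilin.
- exact: (bilin_comp (lid _) (purer 1 \o antipode H)%FUN (@tens_mulr_bilin _ H H)).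
- exact: (bilin_comp (lid H) (tmult (A := H) \o (lid H ⊠ antipode H))%FUN
    (@pure_bilin _ H H)).
- by move=> a b c; rewrite pureM mulr1 tmap_pure tmult_pure.
Qed.

Lemma antipode_comul_bilin :
  bilin (fun a b : H => hcomul (antipode H a) * (b ⊗ₜ 1)).
Proof.
exact: (bilin_comp (hcomul \o antipode H)%FUN (purel 1)
  (@tens_mulr_bilin _ H H)).
Qed.

(** [Δ(S x₁) (x₂ ⊗ 1) = 1 ⊗ S x] *)
Lemma antipode_comul (x : H) :
  tlift (fun a b => hcomul (antipode H a) * (b ⊗ₜ 1)) (hcomul x) =
  1 ⊗ₜ antipode H x.
Proof.
have NB : bilin (fun b c : H => hcomul b * (1 ⊗ₜ antipode H c)).
  exact: (bilin_comp hcomul (purer 1 \o antipode H)%FUN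
    (@tens_mulr_bilin _ H H)).
(* Expanding [b ⊗ 1] as [Δ(b₁) (1 ⊗ S(b₂))] gives [Δ(S(x₁)) Δ(x₂) (1 ⊗ S(x₃))]. The first two
   factors form [Δ(S(x₁) x₂)], where the antipode axiom applies. *)
under eq_tlift => a b do rewrite -comul_antipode_contract.
rewrite -(@comul3 _
  (fun u c => hcomul (tmult ((antipode H ⊠ lid H) u)) * (1 ⊗ₜ antipode H c))
  (fun a v => hcomul (antipode H a) *
    tlift (fun b c => hcomul b * (1 ⊗ₜ antipode H c)) v)).
- under eq_tlift => a c.
    rewrite antipodel linearZ /= hcomul1 tens_mulZl pureM !mul1r -pureZr -linearZ.
    over.
  rewrite -[x in RHS]hcounitl.
  rewrite -[RHS]/((purer 1 \o antipode H)%FUN (tlift _ _)) linear_tlift //.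
  exact: tcontl_bilin.
- exact: (bilin_comp (hcomul \o (tmult (A := H) \o (antipode H ⊠ lid H)))%FUN
    (purer 1 \o antipode H)%FUN (@tens_mulr_bilin _ H H)).
- exact: (bilin_comp (hcomul \o antipode H)%FUN (linear_of_tlift NB)
    (@tens_mulr_bilin _ H H)).
- move=> a b c; rewrite tmap_pure tmult_pure hcomulM (tlift_pure NB).
  by rewrite mulrA.
Qed.

Lemma antipode_mul_bilin (x : H) : bilin (fun b c : H => b * antipode H (x * c)).
Proof.
exact: (bilin_comp (lid H) (antipode H \o hlmul x)%FUN (@mul_bilin _ H)).
Qed.

(** [a₁ S(x a₂) = ε(a) S x] *)
Lemma antipode_mul (x a : H) :
  tlift (fun b c => b * antipode H (x * c)) (hcomul a) =
  hcounit a *: antipode H x.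
Proof.
(* With [a] fixed, the left side is a linear map [T] of [x]. The computation is
   [T(x) = ε(x₁) T(x₂) = S(x₁) x₂ T(x₃)], regrouped so that [r₁ T(r₂) = ε(r a) 1] applies to the
   last two factors. *)
pose T0 (x : H) : H := tlift (fun b c => b * antipode H (x * c)) (hcomul a).
have TB := antipode_mul_bilin.
have T0D y z : T0 (y + z) = T0 y + T0 z.
  rewrite /T0; elim/tens_ind: (hcomul a) => [b c|u v hu hv].
    by rewrite !(tlift_pure (TB _)) mulrDl linearD mulrDr.
  by rewrite !(tliftD (TB _)) hu hv addrACA.
have T0L : linear T0.
  move=> s y z; rewrite T0D; congr (_ + _).
  rewrite /T0; elim/tens_ind: (hcomul a) => [b c|u v hu hv].
    by rewrite !(tlift_pure (TB _)) -scalerAl linearZ -scalerAr.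
  by rewrite !(tliftD (TB _)) hu hv scalerDr.
pose T : {linear H -> H} :=
  HB.pack_for {linear H -> H} T0 (GRing.isLinear.Build k H H _ T0 T0L).
have MB := bilin_comp (lid H) T (@mul_bilin _ H).
(* At [z = Δ(r)] the right side is [y₁ S(y₂)] for [y = r a], which the antipode axiom evaluates. *)
have ME z : tlift (fun q r : H => q * T r) z =
    tmult ((lid H ⊠ antipode H) (z * hcomul a)).
  elim/tens_ind: z => [q r|y z hy hz]; last first.
    by rewrite (tliftD MB) hy hz mulrDl tmapD linearD.
  rewrite (tlift_pure MB) /T /= /T0; elim/tens_ind: (hcomul a) => [b c|u v hu hv].
    by rewrite (tlift_pure (TB _)) pureM tmap_pure tmult_pure mulrA.
  by rewrite (tliftD (TB _)) mulrDr hu hv mulrDr tmapD linearD.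
rewrite -[LHS]/(T x) -[x in LHS]hcounitl.
rewrite linear_tlift; last exact: tcontl_bilin.
have TE p r : T (hcounit p *: r) =
    tmult ((antipode H ⊠ lid H) (hcomul p)) * T r.
  by rewrite antipodel -scalerAl mul1r linearZ.
under eq_tlift => p r do rewrite TE.
rewrite (@comul3 _ (fun u r => tmult ((antipode H ⊠ lid H) u) * T r)
  (fun p v => antipode H p * tlift (fun q r => q * T r) v)).
- under eq_tlift => p r.
    rewrite ME -hcomulM antipoder hcounitM -scalerAr mulr1 mulrC -scalerA.
    rewrite -[hcounit r *: _]linearZ /=; over.
  rewrite -[x in RHS]hcounitr.
  rewrite -[RHS]/((hcounit a \*: antipode H) (tlift _ _)) linear_tlift //.
  exact: tcontr_bilin.
- exact: (bilin_comp (tmult (A := H) \o (antipode H ⊠ lid H))%FUN T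
    (@mul_bilin _ H)).
- exact: (bilin_comp (antipode H) (linear_of_tlift MB) (@mul_bilin _ H)).
- by move=> p q r; rewrite tmap_pure tmult_pure (tlift_pure MB) mulrA.
Qed.

End Antipode.

(** * Induced modules as comodules *)

Section Induced.
Variables (k : fieldType) (H : hopfAlgebra k) (A : rcoidSubalgebra H).

Local Notation C := (quot_coalgebra A).
Local Notation HA := (pullback_rmod (subalg_incl A)).
Local Notation cpi := (cpi A).

Section Module.
Variable U : lmodType (subalg A).

(** [H ⊗_A U], as a vector space through [H] *)
Definition hind : Type := rtens HA U.
HB.instance Definition _ := GRing.Zmodule.on hind.

Definition hpure (h : H) (u : U) : hind := rpure (h : HA) u.

Lemma hpureDl h h' u : hpure (h + h') u = hpure h u + hpure h' u.
Proof. exact: rpureDl. Qed.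

Lemma hpureDr h u u' : hpure h (u + u') = hpure h u + hpure h u'.
Proof. exact: rpureDr. Qed.

Lemma hpureM h (a : subalg A) u : hpure (h * val a) u = hpure h (a *: u).
Proof. exact: (@rpureM _ HA U a h u). Qed.

Lemma hind_ind (P : hind -> Prop) :
  (forall h u, P (hpure h u)) -> (forall x y, P x -> P y -> P (x + y)) ->
  forall x, P x.
Proof. exact: (@rtens_ind _ HA U P). Qed.

Definition hact (h : H) : hind -> hind :=
  rlift (fun (x : HA) u => hpure (h * x) u).

Fact hact_balanced h : rbalanced (fun (x : HA) u => hpure (h * x) u).
Proof.
split=> [x x' u|x u u'|a x u]; rewrite ?mulrDr ?hpureDl ?hpureDr //.
by rewrite -hpureM -mulrA.
Qed.

Lemma hact_pure h x u : hact h (hpure x u) = hpure (h * x) u.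
Proof. exact: rlift_pure (hact_balanced h). Qed.

Lemma hactDr h : {morph hact h : x y / x + y}.
Proof. exact: rliftD (hact_balanced h). Qed.

Lemma hactDl h h' x : hact (h + h') x = hact h x + hact h' x.
Proof.
elim/hind_ind: x => [y u|x y hx hy]; first by rewrite !hact_pure mulrDl hpureDl.
by rewrite !hactDr hx hy addrACA.
Qed.

Lemma hactM h h' x : hact (h * h') x = hact h (hact h' x).
Proof.
elim/hind_ind: x => [y u|x y hx hy]; first by rewrite !hact_pure mulrA.
by rewrite !hactDr hx hy.
Qed.

Lemma hact1 x : hact 1 x = x.
Proof.
elim/hind_ind: x => [y u|x y hx hy]; first by rewrite !hact_pure mul1r.
by rewrite !hactDr hx hy.
Qed.

Definition hind_scale (c : k) (x : hind) : hind := hact c%:A x.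

Fact hind_scaleA a b x : hind_scale a (hind_scale b x) = hind_scale (a * b) x.
Proof. by rewrite /hind_scale -hactM mulr_algl scalerA. Qed.

Fact hind_scale1 : left_id 1 hind_scale.
Proof. by move=> x; rewrite /hind_scale scale1r hact1. Qed.

Fact hind_scaleDr : right_distributive hind_scale +%R.
Proof. by move=> a x y; exact: hactDr. Qed.

Fact hind_scaleDl x : {morph hind_scale^~ x : a b / a + b}.
Proof. by move=> a b; rewrite /hind_scale scalerDl hactDl. Qed.

HB.instance Definition _ := GRing.Zmodule_isLmodule.Build k hind
  hind_scaleA hind_scale1 hind_scaleDr hind_scaleDl.

Lemma hpureZ c h u : hpure (c *: h) u = c *: hpure h u.
Proof. by rewrite [RHS]hact_pure mulr_algl. Qed.

Lemma hactZl c h x : hact (c *: h) x = c *: hact h x.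
Proof. by rewrite -[RHS]/(hact c%:A (hact h x)) -hactM mulr_algl. Qed.

Fact hact_is_linear h : linear (hact h).
Proof.
move=> c x y; rewrite hactDr -hactZl; congr (_ + _).
rewrite -[c *: x]/(hact c%:A x) -hactM; congr hact.
by rewrite -scalerAr mulr1.
Qed.

HB.instance Definition _ h := GRing.isLinear.Build k hind hind _ (hact h)
  (hact_is_linear h).

Definition hpurel (u : U) (h : H) : hind := hpure h u.

Fact hpurel_is_linear u : linear (hpurel u).
Proof. by move=> c h h'; rewrite /hpurel hpureDl hpureZ. Qed.

HB.instance Definition _ u := GRing.isLinear.Build k H hind _ (hpurel u)
  (hpurel_is_linear u).

Definition hind_coact_fun : hind -> C ⊗ hind :=
  rlift (fun (h : HA) u => (cpi ⊠ hpurel u) (hcomul (h : H))).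

(** Compatibility with [A] is [π(h₁ a₁) ⊗ h₂ a₂ = π(h₁) ⊗ h₂ a]: the factor [a₁] lies in [A], hence
    acts under [π] through the counit. *)
Fact hind_coact_balanced :
  rbalanced (fun (h : HA) u => (cpi ⊠ hpurel u) (hcomul (h : H))).
Proof.
split=> [h h' u|h u u'|a h u].
- by rewrite linearD tmapD.
- elim/tens_ind: (hcomul _) => [v w|x y hx hy].
    by rewrite !tmap_pure /= /hpurel hpureDr pureDr.
  by rewrite !tmapD hx hy addrACA.
rewrite -[(a : _^c) *: h]/((h : H) * val a) hcomulM cpi_comul_mul; last exact: valP.
elim/tens_ind: (hcomul _) => [v w|x y hx hy].
  by rewrite pureM !tmap_pure mulr1 /= /hpurel hpureM.
by rewrite mulrDl !tmapD hx hy.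
Qed.

Lemma hind_coact_fun_pure h u :
  hind_coact_fun (hpure h u) = (cpi ⊠ hpurel u) (hcomul h).
Proof. exact: rlift_pure hind_coact_balanced. Qed.

Fact hind_coact_is_linear : linear hind_coact_fun.
Proof.
move=> c x y; rewrite /hind_coact_fun (rliftD hind_coact_balanced).
congr (_ + _); rewrite -/hind_coact_fun.
elim/hind_ind: x => [h u|x z hx hz].
  by rewrite -hpureZ !hind_coact_fun_pure !linearZ.
rewrite scalerDr /hind_coact_fun !(rliftD hind_coact_balanced).
by rewrite -/hind_coact_fun hx hz scalerDr.
Qed.

HB.instance Definition _ := GRing.isLinear.Build k hind (tens C hind) _
  hind_coact_fun hind_coact_is_linear.

Definition hind_coact : {linear hind -> C ⊗ hind} := hind_coact_fun.

Lemma hind_coact_pure h u :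
  hind_coact (hpure h u) = (cpi ⊠ hpurel u) (hcomul h).
Proof. exact: hind_coact_fun_pure. Qed.

Fact hind_coact_assoc x :
  tassoc ((comul ⊠ lid hind) (hind_coact x)) =
  (lid C ⊠ hind_coact) (hind_coact x).
Proof.
elim/hind_ind: x => [h u|x y hx hy]; last first.
  by rewrite [hind_coact _]linearD !tmapD tassocD hx hy.
rewrite hind_coact_pure !tmap_comp.
rewrite (@eq_tmap _ _ _ _ _ (ccomul A \o cpi)%FUN ((cpi ⊠ cpi) \o hcomul)%FUN
  (lid _ \o hpurel u)%FUN (hpurel u \o lid H)%FUN (@ccomul_pi _ _ _) (frefl _)).
rewrite (@eq_tmap _ _ _ _ _ (lid _ \o cpi)%FUN (cpi \o lid H)%FUN
  (hind_coact \o hpurel u)%FUN ((cpi ⊠ hpurel u) \o hcomul)%FUN (frefl _)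
  (hind_coact_pure^~ u)).
by rewrite -!tmap_comp tassoc_tmap hcomulA.
Qed.

Fact hind_coact_unit x : tcontl counit (hind_coact x) = x.
Proof.
elim/hind_ind: x => [h u|x y hx hy]; last first.
  by rewrite [hind_coact _]linearD tcontlD hx hy.
rewrite hind_coact_pure -[in RHS](coalg_unitl (hopf_coalgP H) h).
rewrite -/(hpurel u _); elim/tens_ind: (hcomul h) => [v w|x y hx hy].
  by rewrite tmap_pure !tcontl_pure ccounit_pi linearZ.
by rewrite tmapD !tcontlD hx hy linearD.
Qed.

Definition hind_comodule : lcomodule C :=
  LComodule hind_coact_assoc hind_coact_unit.

Definition hind_coinv (x : hind) : Prop := hind_coact x = cpi 1 ⊗ₜ x.

(** The componentwise action of [H ⊗ H], by which an element of [H] acts through its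
    comultiplication. *)
Definition hact2 (t : H ⊗ H) (y : C ⊗ hind) : C ⊗ hind :=
  tlift (fun p q => (clmul A p ⊠ hact q) y) t.

Lemma clmulP c p q x : clmul A (c *: p + q) x = c *: clmul A p x + clmul A q x.
Proof.
by elim/quot_ind: x => h; rewrite !clmul_pi mulrDl -scalerAl linearP.
Qed.

Fact hact2_bilin (y : C ⊗ hind) : bilin (fun p q => (clmul A p ⊠ hact q) y).
Proof.
have Dl p p' q : (clmul A (p + p') ⊠ hact q) y =
    (clmul A p ⊠ hact q) y + (clmul A p' ⊠ hact q) y.
  elim/tens_ind: y => [c v|y y' hy hy']; last by rewrite !tmapD hy hy' addrACA.
  by rewrite !tmap_pure -[p in LHS]scale1r clmulP scale1r pureDl.
have Dr p q q' : (clmul A p ⊠ hact (q + q')) y =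
    (clmul A p ⊠ hact q) y + (clmul A p ⊠ hact q') y.
  elim/tens_ind: y {Dl} => [c v|y y' hy hy'].
    by rewrite !tmap_pure /= hactDl pureDr.
  by rewrite !tmapD hy hy' addrACA.
split=> // [a p q|a p q].
  elim/tens_ind: y {Dl Dr} => [c v|y y' hy hy'].
    rewrite !tmap_pure -pureZl; congr (_ ⊗ₜ _).
    by elim/quot_ind: c => h; rewrite !clmul_pi -scalerAl linearZ.
  by rewrite !tmapD hy hy' scalerDr.
elim/tens_ind: y {Dl Dr} => [c v|y y' hy hy'].
  by rewrite !tmap_pure /= hactZl pureZr.
by rewrite !tmapD hy hy' scalerDr.
Qed.

Lemma hact2_pure p q y : hact2 (p ⊗ₜ q) y = (clmul A p ⊠ hact q) y.
Proof. exact: (tlift_pure (hact2_bilin y)). Qed.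

Lemma hact2Dl t t' y : hact2 (t + t') y = hact2 t y + hact2 t' y.
Proof. exact: (tliftD (hact2_bilin y)). Qed.

Lemma hact2Zl c t y : hact2 (c *: t) y = c *: hact2 t y.
Proof. exact: (tliftZ _ (hact2_bilin y)). Qed.

Lemma hact2Dr t y y' : hact2 t (y + y') = hact2 t y + hact2 t y'.
Proof.
elim/tens_ind: t => [p q|t t' ht ht']; first by rewrite !hact2_pure tmapD.
by rewrite !hact2Dl ht ht' addrACA.
Qed.

Lemma hact2Zr c t y : hact2 t (c *: y) = c *: hact2 t y.
Proof.
elim/tens_ind: t => [p q|t t' ht ht']; first by rewrite !hact2_pure tmapZ.
by rewrite !hact2Dl ht ht' scalerDr.
Qed.

(** As a left [H]-module, [C] is generated by [π(1)], so [x] can be moved into the acting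
    element. *)
Lemma hact2_cpi t (x : H) v :
  hact2 t (cpi x ⊗ₜ v) = hact2 (t * (x ⊗ₜ 1)) (cpi 1 ⊗ₜ v).
Proof.
elim/tens_ind: t => [p q|t t' ht ht'].
  by rewrite pureM !hact2_pure !tmap_pure !clmul_pi !mulr1.
by rewrite mulrDl !hact2Dl ht ht'.
Qed.

(** The Hopf module compatibility of the [H]-action with the [C]-coaction; on pure tensors it is
    multiplicativity of [Δ]. *)
Lemma hind_coact_act h x : hind_coact (hact h x) = hact2 (hcomul h) (hind_coact x).
Proof.
elim/hind_ind: x => [y u|x y hx hy]; last first.
  by rewrite hactDr ![hind_coact (_ + _)]linearD hact2Dr hx hy.
rewrite hact_pure !hind_coact_pure hcomulM.
elim/tens_ind: (hcomul h) => [p q|s t hs ht]; last first.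
  by rewrite mulrDl tmapD hact2Dl hs ht.
rewrite hact2_pure; elim/tens_ind: (hcomul y) => [a b|s t hs ht]; last first.
  by rewrite mulrDr !tmapD hs ht.
by rewrite pureM !tmap_pure clmul_pi /= /hpurel hact_pure.
Qed.

(** [x ⊗ v ↦ S(x) v] maps the cotensor product [H □_C (H ⊗_A U)] to the
    coinvariants and has the section [v ↦ 1 ⊗ v], which is how exactness of
    [H □_C ?] passes to coinvariants. *)
Definition antipode_act : H ⊗ hind -> hind :=
  tlift (fun x v => hact (antipode H x) v).

Fact antipode_act_bilin : bilin (fun x v => hact (antipode H x) v).
Proof.
have B : bilin hact.
  by split=> *; [exact: hactDl | exact: hactDr | exact: hactZl | rewrite linearZ].
exact: (bilin_comp (antipode H) (lid hind) B).
Qed.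

Lemma antipode_act_pure x v :
  antipode_act (x ⊗ₜ v) = hact (antipode H x) v.
Proof. exact: (tlift_pure antipode_act_bilin). Qed.

Lemma antipode_actD : {morph antipode_act : x y / x + y}.
Proof. exact: (tliftD antipode_act_bilin). Qed.

(** Applied to both sides of the equation defining the cotensor product, this map yields
    coinvariance of [antipode_act z]. One side is [hind_coact_antipode], the other
    [antipode_act2_hcoact]. *)
Definition antipode_act2 : H ⊗ (C ⊗ hind) -> C ⊗ hind :=
  tlift (fun x y => hact2 (hcomul (antipode H x)) y).

Fact antipode_act2_bilin :
  bilin (fun x y => hact2 (hcomul (antipode H x)) y).
Proof.
have B : bilin hact2.
  by split; [exact: hact2Dl | exact: hact2Dr | exact: hact2Zl | exact: hact2Zr].
exact: (bilin_comp (hcomul \o antipode H)%FUN (lid _) B).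
Qed.

Lemma antipode_act2_pure x y :
  antipode_act2 (x ⊗ₜ y) = hact2 (hcomul (antipode H x)) y.
Proof. exact: (tlift_pure antipode_act2_bilin). Qed.

Lemma antipode_act2D : {morph antipode_act2 : x y / x + y}.
Proof. exact: (tliftD antipode_act2_bilin). Qed.

Lemma hind_coact_antipode z :
  hind_coact (antipode_act z) = antipode_act2 ((lid H ⊠ hind_coact) z).
Proof.
elim/tens_ind: z => [x v|y z hy hz]; last first.
  by rewrite antipode_actD [hind_coact (_ + _)]linearD tmapD antipode_act2D hy hz.
by rewrite tmap_pure antipode_act_pure antipode_act2_pure hind_coact_act.
Qed.

(** For [z = x ⊗ v] the left side is [Δ(S(x₁)) (π(x₂) ⊗ v) = Δ(S(x₁)) (x₂ ⊗ 1) (π(1) ⊗ v)], and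
    [antipode_comul] replaces the acting element by [1 ⊗ S(x)]. *)
Lemma antipode_act2_hcoact z :
  antipode_act2 (tassoc ((hcoact A ⊠ lid hind) z)) = cpi 1 ⊗ₜ antipode_act z.
Proof.
elim/tens_ind: z => [x v|y z hy hz]; last first.
  by rewrite tmapD tassocD antipode_act2D antipode_actD pureDr hy hz.
have SB := antipode_comul_bilin H.
have E t : antipode_act2 (tassoc ((lid H ⊠ cpi) t ⊗ₜ v)) =
    hact2 (tlift (fun a b => hcomul (antipode H a) * (b ⊗ₜ 1)) t) (cpi 1 ⊗ₜ v).
  elim/tens_ind: t => [a b|s t hs ht]; last first.
    by rewrite tmapD pureDl tassocD antipode_act2D hs ht (tliftD SB) hact2Dl.
  by rewrite tmap_pure tassoc_pure antipode_act2_pure [LHS]hact2_cpi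
    (tlift_pure SB).
rewrite tmap_pure E antipode_comul hact2_pure tmap_pure clmul_pi mulr1.
by rewrite antipode_act_pure.
Qed.

Lemma antipode_act_coinv (z : H ⊗ hind) :
  z \in @cotens_pred _ _ (hopf_rcomodule A) hind_comodule ->
  hind_coinv (antipode_act z).
Proof.
move=> /eqP hz; rewrite /hind_coinv hind_coact_antipode.
by rewrite -antipode_act2_hcoact; congr antipode_act2.
Qed.

Lemma coinv_cotens (x : hind) : hind_coinv x ->
  1 ⊗ₜ x \in @cotens_pred _ _ (hopf_rcomodule A) hind_comodule.
Proof.
move=> hx; apply/eqP; rewrite !tmap_pure /= hx /hcoact /= hcomul1 tmap_pure.
exact: tassoc_pure.
Qed.

Definition coinv_to_cotens (x : hind) (hx : hind_coinv x) :
    cotens (hopf_rcomodule A) hind_comodule :=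
  exist (fun y => y \in @cotens_pred _ _ (hopf_rcomodule A) hind_comodule)
    (1 ⊗ₜ x) (coinv_cotens hx).

End Module.

Section Map.
Variables (U V : lmodType (subalg A)) (f : {linear U -> V}).

Definition hind_map : hind U -> hind V := rtens_map f.

Lemma hind_map_pure h u : hind_map (hpure h u) = hpure h (f u).
Proof. exact: rtens_map_pure. Qed.

Fact hind_mapD : {morph hind_map : x y / x + y}.
Proof. exact: rtens_mapD. Qed.

Lemma hind_map_act h x : hind_map (hact h x) = hact h (hind_map x).
Proof.
elim/hind_ind: x => [y u|x y hx hy].
  by rewrite !(hact_pure, hind_map_pure).
by rewrite !(hactDr, hind_mapD) hx hy.
Qed.

Fact hind_map_is_linear : linear hind_map.
Proof.
move=> c x y; rewrite hind_mapD; congr (_ + _).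
exact: hind_map_act.
Qed.

HB.instance Definition _ := GRing.isLinear.Build k (hind U) (hind V) _ hind_map
  hind_map_is_linear.

Fact hind_map_colinear x :
  hind_coact V (hind_map x) = (lid C ⊠ hind_map) (hind_coact U x).
Proof.
elim/hind_ind: x => [h u|x y hx hy]; last first.
  by rewrite hind_mapD ![hind_coact _ (_ + _)]linearD tmapD hx hy.
rewrite hind_map_pure !hind_coact_pure tmap_comp.
by apply: eq_tmap => y //=; rewrite /hpurel hind_map_pure.
Qed.

Definition hind_hom : lcomod_hom (hind_comodule U) (hind_comodule V) :=
  @LComodHom _ _ (hind_comodule U) (hind_comodule V) hind_map hind_map_colinear.

Lemma antipode_act_map z :
  antipode_act ((lid H ⊠ hind_map) z) = hind_map (antipode_act z).
Proof.
elim/tens_ind: z => [x v|y z hy hz]; last first.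
  by rewrite tmapD !antipode_actD hy hz hind_mapD.
by rewrite tmap_pure !antipode_act_pure hind_map_act.
Qed.

(** The preimage is [antipode_act (val z)]: by naturality it maps to [antipode_act (1 ⊗ y)], which
    is [y] because [S(1) = 1]. *)
Lemma hind_coinv_lift y (z : cotens (hopf_rcomodule A) (hind_comodule U)) :
  (lid H ⊠ hind_map) (val z) = 1 ⊗ₜ y ->
  exists2 x, hind_coinv x & hind_map x = y.
Proof.
move=> zy; exists (antipode_act (val z)); first exact/antipode_act_coinv/valP.
by rewrite -antipode_act_map zy antipode_act_pure antipode1 hact1.
Qed.

End Map.

(** * Exactness on coinvariants *)

Section Exact.
Variables (U V W : lmodType (subalg A)).
Variables (f : {linear U -> V}) (g : {linear V -> W}).
Hypothesis H_flat : right_flat HA.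
Hypothesis H_coflat : coflat (hopf_rcomodule A).
Hypothesis fg : short_exact f g.

(** Flatness makes the induced sequence of left [C]-comodules exact, and coflatness then keeps it
    exact under [H □_C ?]. *)
Let cofg : short_exact
  (cotens_map (M := hopf_rcomodule A) (hind_hom f))
  (cotens_map (M := hopf_rcomodule A) (hind_hom g)).
Proof. by apply: H_coflat; have := H_flat fg. Qed.

Lemma hind_coinv_surj w : hind_coinv w ->
  exists2 v, hind_coinv v & hind_map g v = w.
Proof.
move=> wC; have [_ _ gs] := cofg.
have [z zw] := gs (coinv_to_cotens wC).
by apply: (@hind_coinv_lift _ _ _ _ z); have := congr1 val zw.
Qed.

Lemma hind_coinv_exact v : hind_coinv v -> hind_map g v = 0 ->
  exists2 u, hind_coinv u & hind_map f u = v.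
Proof.
move=> vC gv; have [_ ex _] := cofg.
have [|z zv] := (ex (coinv_to_cotens vC)).1.
  by apply: val_inj; rewrite /= tmap_pure /= gv -(scale0r 0) pureZr scale0r.
by apply: (@hind_coinv_lift _ _ _ _ z); have := congr1 val zv.
Qed.

End Exact.

End Induced.

(** * Coinvariants of induced modules *)

Section Comparison.
Variables (k : fieldType) (H : hopfAlgebra k) (A : rcoidSubalgebra H).

Local Notation C := (quot_coalgebra A).
Local Notation HA := (pullback_rmod (subalg_incl A)).
Local Notation CA := (pullback_rmod (coinv_incl A)).
Local Notation cpi := (cpi A).

Definition coinv_val_fun (s : CA) : HA := val (s : subalg (coinv A)).

Fact coinv_val_is_linear : linear coinv_val_fun.
Proof. by []. Qed.

HB.instance Definition _ := GRing.isLinear.Build (subalg A)^c CA HA _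
  coinv_val_fun coinv_val_is_linear.

Definition coinv_val : {linear CA -> HA} := coinv_val_fun.

Section Module.
Variable U : lmodType (subalg A).

Definition coinv_ind : rtens CA U -> hind U := rtens_mapl coinv_val.

HB.instance Definition _ := GRing.Additive.on coinv_ind.

Lemma coinv_indB z z' : coinv_ind (z - z') = coinv_ind z - coinv_ind z'.
Proof. exact: (raddfB (rtens_mapl coinv_val)). Qed.

Lemma coinv_indD : {morph coinv_ind : x y / x + y}.
Proof. exact: rtens_maplD. Qed.

Lemma coinv_ind_pure (s : CA) u : coinv_ind (rpure s u) = hpure (coinv_val s) u.
Proof. exact: rtens_mapl_pure. Qed.

Lemma coinv_ind_coinv z : hind_coinv (coinv_ind z).
Proof.
rewrite /hind_coinv; elim/rtens_ind: z => [s u|y z hy hz]; last first.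
  by rewrite coinv_indD linearD pureDr hy hz.
rewrite coinv_ind_pure hind_coact_pure.
have /coinvP sC := valP (s : subalg (coinv A)).
have -> t : (cpi ⊠ hpurel u) t = (lid _ ⊠ hpurel u) ((cpi ⊠ lid H) t).
  by rewrite tmap_comp; apply: eq_tmap.
by rewrite sC tmap_pure.
Qed.

End Module.

Lemma coinv_ind_map (U V : lmodType (subalg A)) (f : {linear U -> V}) z :
  coinv_ind (rtens_map f z) = hind_map f (coinv_ind z).
Proof. exact: rtens_mapl_map. Qed.

(** * Coinvariants over a free module *)

Section Free.
Variable X : choiceType.
Local Notation F := {freeg X / (subalg A)}.

Definition hind_coef (x : X) (z : hind F) : H := rtens_coef (M := HA) x z.

Lemma hind_coef_pure x h D : hind_coef x (hpure h D) = h * val (coeff x D).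
Proof. exact: (@rtens_coef_pure _ _ HA). Qed.

Lemma hind_coefD x : {morph hind_coef x : y z / y + z}.
Proof. exact: rtens_coefD. Qed.

Fact hind_coef_is_linear x : linear (hind_coef x).
Proof.
move=> c y z; rewrite hind_coefD; congr (_ + _).
elim/hind_ind: y => [h D|y y' hy hy'].
  by rewrite -hpureZ !hind_coef_pure scalerAl.
by rewrite scalerDr !hind_coefD hy hy' scalerDr.
Qed.

HB.instance Definition _ x := GRing.isLinear.Build k (hind F) H _ (hind_coef x)
  (hind_coef_is_linear x).

(** Taking a coefficient is a map of left [C]-comodules to [H], since right multiplication by an
    element of [A] commutes with the coaction. Hence the coefficients of a coinvariant lie in
    [A']. *)
Lemma hind_coef_comul x z :
  (cpi ⊠ lid H) (hcomul (hind_coef x z)) = (lid C ⊠ hind_coef x) (hind_coact F z).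
Proof.
elim/hind_ind: z => [h D|y z hy hz]; last first.
  by rewrite hind_coefD [hcomul _]linearD [hind_coact _ _]linearD !tmapD hy hz.
rewrite hind_coef_pure hind_coact_pure hcomulM cpi_comul_mul; last exact: valP.
rewrite tmap_comp; elim/tens_ind: (hcomul h) => [p q|y z hy hz].
  by rewrite pureM !tmap_pure mulr1 /= /hpurel hind_coef_pure.
by rewrite mulrDl !tmapD hy hz.
Qed.

Lemma hind_coef_coinv x z : hind_coinv z -> hind_coef x z \in coinv A.
Proof. by move=> hz; apply/coinvP; rewrite hind_coef_comul hz tmap_pure. Qed.

Lemma coinv_ind_free_surj w : hind_coinv w ->
  exists z : rtens CA F, coinv_ind z = w.
Proof.
move=> wC; have [s ws] := rtens_coef_sum (w : rtens HA F).
pose c x : CA := exist (fun h => h \in coinv A) _ (hind_coef_coinv x wC).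
exists (\sum_(x <- s) rpure (c x) (<< x >> : F)); rewrite [RHS]ws.
rewrite (raddf_sum (rtens_mapl coinv_val)); apply: eq_bigr => x _.
exact: coinv_ind_pure.
Qed.

Lemma hind_coef_ind x z :
  hind_coef x (coinv_ind z) = coinv_val (rtens_coef (M := CA) x z).
Proof.
elim/rtens_ind: z => [s D|y z hy hz].
  by rewrite coinv_ind_pure hind_coef_pure rtens_coef_pure.
by rewrite coinv_indD hind_coefD hy hz rtens_coefD.
Qed.

(** The coefficients in [A'] determine an element of the source, and [coinv_ind] only includes them
    into [H]. *)
Lemma coinv_ind_free_inj : injective (@coinv_ind F).
Proof.
move=> z z' zz'; apply/eqP; rewrite -subr_eq0; apply/eqP.
have z0 : coinv_ind (z - z') = 0 by rewrite coinv_indB zz' subrr.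
have [s ->] := rtens_coef_sum (z - z').
rewrite big1 // => x _.
suff -> : rtens_coef (M := CA) x (z - z') = 0 by rewrite rpure0l.
by apply: val_inj; have := hind_coef_ind x (z - z'); rewrite z0 linear0 => <-.
Qed.

End Free.

Hypothesis H_flat : right_flat HA.
Hypothesis H_coflat : coflat (hopf_rcomodule A).

Section Presentation.
Variable U : lmodType (subalg A).
(** The canonical free cover of [U], with all elements of [U] as basis. *)
Let g : {linear {freeg U / (subalg A)} -> U} := freeg_lift id.

Let g_exact : short_exact (ker_val g) g.
Proof.
by apply: ker_short_exact => u; exists << u >>; rewrite /g freeg_lift_gen.
Qed.

(** A coinvariant lifts along the free cover to a coinvariant, where the free case applies;
    naturality of [coinv_ind] brings the result back. *)
Lemma coinv_ind_surj w : hind_coinv w -> exists z : rtens CA U, coinv_ind z = w.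
Proof.
move=> /(hind_coinv_surj H_flat H_coflat g_exact)[v vC <-].
have [z <-] := coinv_ind_free_surj vC.
by exists (rtens_map g z); rewrite coinv_ind_map.
Qed.

End Presentation.

(** A four lemma argument: surjectivity onto the coinvariants for the kernel of the free cover and
    injectivity for the free module give injectivity for [U]. *)
Lemma coinv_ind_inj (U : lmodType (subalg A)) : injective (@coinv_ind U).
Proof.
pose g : {linear {freeg U / (subalg A)} -> U} := freeg_lift id.
have gs u : exists D, g D = u by exists << u >>; rewrite /g freeg_lift_gen.
have g_exact := ker_short_exact gs.
move=> z z' zz'; apply/eqP; rewrite -subr_eq0; apply/eqP.
have : coinv_ind (z - z') = 0 by rewrite coinv_indB zz' subrr.
have [y <-] := rtens_map_surj (M := CA) gs (z - z').
rewrite coinv_ind_map => y0.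
(* The image of [y] in the induced free module is a coinvariant killed by [g], so it comes from a
   coinvariant over [ker g], which in turn lifts to [t]. *)
have [x xC xy] := hind_coinv_exact H_flat H_coflat g_exact (coinv_ind_coinv y) y0.
have [t tx] := coinv_ind_surj xC.
have <- : rtens_map (ker_val g) t = y.
  by apply: coinv_ind_free_inj; rewrite coinv_ind_map tx.
elim/rtens_ind: t {tx} => [s u|t t' ht ht'].
  by rewrite !rtens_map_pure (eqP (valP u)) rpure0r.
by rewrite !rtens_mapD ht ht' addr0.
Qed.

(** Through [coinv_ind], the functor [A' ⊗_A ?] is identified with the coinvariants of [H ⊗_A ?] and
    inherits their exactness. *)
Lemma coinv_flat : right_flat CA.
Proof.
move=> U V W f g fg; have [f_inj gf g_surj] := fg; have [Hf Hgf _] := H_flat fg.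
split=> [x y xy|v|]; last exact: rtens_map_surj.
  apply: coinv_ind_inj; apply: Hf.
  by rewrite -!/(hind_map f _) -!coinv_ind_map xy.
split=> [gv|[u <-]]; last first.
  apply: coinv_ind_inj; rewrite !coinv_ind_map [coinv_ind 0]raddf0.
  by apply/Hgf; exists (coinv_ind u).
have gv0 : hind_map g (coinv_ind v) = 0.
  by rewrite -coinv_ind_map gv; exact: raddf0.
(* The preimage has to be coinvariant in order to come from [A' ⊗_A U]; flatness of [H] alone would
   give just some preimage in [H ⊗_A U]. *)
have [u uC uv] := hind_coinv_exact H_flat H_coflat fg (coinv_ind_coinv v) gv0.
have [z zu] := coinv_ind_surj uC; exists z.
by apply: coinv_ind_inj; rewrite coinv_ind_map zu.
Qed.

End Comparison.

(** * The epimorphism property *)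

Definition pullback_lmod (R S : pzRingType) (f : {rmorphism R -> S}) : Type := S.

Section PullbackLmod.
Variables (R S : pzRingType) (f : {rmorphism R -> S}).
Local Notation pullback_lmod := (pullback_lmod f).

HB.instance Definition _ := GRing.Zmodule.copy pullback_lmod S.

Definition pullback_lscale (a : R) (s : pullback_lmod) : pullback_lmod :=
  f a * (s : S).

Fact pullback_lscaleA a b s :
  pullback_lscale a (pullback_lscale b s) = pullback_lscale (a * b) s.
Proof. by rewrite /pullback_lscale mulrA -rmorphM. Qed.

Fact pullback_lscale1 : left_id 1 pullback_lscale.
Proof. by move=> s; rewrite /pullback_lscale rmorph1 mul1r. Qed.

Fact pullback_lscaleDr : right_distributive pullback_lscale +%R.
Proof. by move=> a s t; rewrite /pullback_lscale -mulrDr. Qed.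

Fact pullback_lscaleDl s : {morph pullback_lscale^~ s : a b / a + b}.
Proof. by move=> a b; rewrite /pullback_lscale rmorphD mulrDl. Qed.

HB.instance Definition _ := GRing.Zmodule_isLmodule.Build R pullback_lmod
  pullback_lscaleA pullback_lscale1 pullback_lscaleDr pullback_lscaleDl.

(** If [g] and [h] agree on [R], then [s ⊗ t ↦ g(s) h(t)] is well defined over [R]; it sends [s ⊗ 1]
    to [g(s)] and [1 ⊗ s] to [h(s)]. *)
Lemma ring_epi_rpure :
  (forall s : S, rpure (s : pullback_rmod f) (1 : pullback_lmod) =
    rpure (1 : pullback_rmod f) (s : pullback_lmod)) ->
  ring_epi f.
Proof.
move=> f1 T g h gh s.
have B : rbalanced (fun (s : pullback_rmod f) (t : pullback_lmod) =>
    g (s : S) * h (t : S)).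
  split=> [x y z|x y z|a x y]; first by rewrite raddfD mulrDl.
    by rewrite raddfD mulrDr.
  have := gh a => /= ha.
  by rewrite -[(_ : R^c) *: x]/((x : S) * f a) -[a *: y]/(f a * (y : S))
    !rmorphM ha mulrA.
have := congr1 (rlift (fun (s : pullback_rmod f) (t : pullback_lmod) =>
  g (s : S) * h (t : S))) (f1 s).
by rewrite !(rlift_pure _ _ B) !rmorph1 mulr1 mul1r.
Qed.

End PullbackLmod.

Section Epi.
Variables (k : fieldType) (H : hopfAlgebra k) (A : rcoidSubalgebra H).

Local Notation C := (quot_coalgebra A).
Local Notation HA := (pullback_rmod (subalg_incl A)).
Local Notation CA := (pullback_rmod (coinv_incl A)).
Local Notation AH := (pullback_lmod (subalg_incl A)).
Local Notation AC := (pullback_lmod (coinv_incl A)).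
Local Notation cpi := (cpi A).

Definition hh (x y : H) : hind AH := hpure x (y : AH).

Fact hh_bilin : bilin hh.
Proof.
have hhDl x x' y : hh (x + x') y = hh x y + hh x' y by exact: hpureDl.
have hhDr x y y' : hh x (y + y') = hh x y + hh x y' by exact: hpureDr.
split=> // c x y; first exact: hpureZ.
(* A scalar crosses the tensor sign as the element [c%:A] of [A]. *)
rewrite -[RHS]hpureZ -[c *: x]mulr1 -scalerAl scalerAr.
rewrite -[c%:A]/(val (c%:A : subalg A)) hpureM; congr hpure.
exact/esym/(mulr_algl c (y : H)).
Qed.

Lemma hhM x a y : a \in A -> hh (x * a) y = hh x (a * y).
Proof.
move=> aA; exact: (@hpureM _ _ _ AH x (exist (fun h => h \in A) a aA)).
Qed.

Definition rmul_fun (y x : AH) : AH := (x : H) * (y : H).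

Fact rmul_is_linear y : linear (rmul_fun y).
Proof.
move=> a x x'; rewrite /rmul_fun mulrDl; congr (_ + _).
by rewrite -[LHS]mulrA.
Qed.

HB.instance Definition _ y := GRing.isLinear.Build (subalg A) AH AH _
  (rmul_fun y) (rmul_is_linear y).

Definition hhr (z : hind AH) (y : H) : hind AH := hind_map (rmul_fun y) z.

Lemma hhr_hh x y y' : hhr (hh x y) y' = hh x (y * y').
Proof. exact: hind_map_pure. Qed.

Fact hhr_bilin : bilin hhr.
Proof.
have Dl z z' y : hhr (z + z') y = hhr z y + hhr z' y by exact: hind_mapD.
have Zl c z y : hhr (c *: z) y = c *: hhr z y
    by rewrite /hhr linearZ.
split=> // [z y y'|c z y].
  elim/hind_ind: z => [h u|z z' hz hz']; last by rewrite !Dl hz hz' addrACA.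
  by rewrite !hhr_hh mulrDr (bilDr hh_bilin).
elim/hind_ind: z => [h u|z z' hz hz']; last by rewrite !Dl hz hz' scalerDr.
by rewrite !hhr_hh -scalerAr (bilZr hh_bilin).
Qed.

(** The inverse of [H ⊗_A H -> C ⊗ H, x ⊗ y ↦ π(x₁) ⊗ x₂ y] is
    [π(x) ⊗ y ↦ x₁ ⊗ S(x₂) y]; [gal] is its restriction to [y = 1]. *)
Definition hh_antipode : H ⊗ H -> hind AH :=
  tlift (fun p q => hh p (antipode H q)).

Fact hh_antipode_bilin : bilin (fun p q => hh p (antipode H q)).
Proof. exact: (bilin_comp (lid H) (antipode H) hh_bilin). Qed.

HB.instance Definition _ := GRing.isLinear.Build k (tens H H) (hind AH) _
  hh_antipode (tlift_is_linear hh_antipode_bilin).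

Lemma hh_antipode_pure p q : hh_antipode (p ⊗ₜ q) = hh p (antipode H q).
Proof. exact: (tlift_pure hh_antipode_bilin). Qed.

Lemma hh_antipodeD : {morph hh_antipode : x y / x + y}.
Proof. exact: (tliftD hh_antipode_bilin). Qed.

Definition gal : {linear H -> hind AH} := (hh_antipode \o hcomul)%FUN.

(** As [a₁] lies in [A], it crosses the tensor sign: [x₁ a₁ ⊗ S(x₂ a₂) = x₁ ⊗ a₁ S(x₂ a₂)], and
    [antipode_mul] evaluates the second factor. This lets [gal] factor through [C]. *)
Lemma gal_mulA x a : a \in A -> gal (x * a) = hcounit a *: gal x.
Proof.
move=> aA; rewrite /gal /= hcomulM.
elim/tens_ind: (hcomul x) => [p q|s t hs ht]; last first.
  by rewrite mulrDl !hh_antipodeD hs ht scalerDr.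
have [y ay] := rcsP aA.
have TB := antipode_mul_bilin q.
have -> : hh_antipode ((p ⊗ₜ q) * hcomul a) =
    hh p (tlift (fun b c => b * antipode H (q * c)) (hcomul a)).
  rewrite ay; elim/tens_ind: y {ay} => [b c|s t hs ht].
    rewrite tmap_pure pureM hh_antipode_pure (tlift_pure TB) hhM //.
    exact: valP.
  by rewrite tmapD mulrDr hh_antipodeD (tliftD TB) (bilDr hh_bilin) hs ht.
by rewrite antipode_mul hh_antipode_pure (bilZr hh_bilin).
Qed.

Fact gal_ker x : x \in Haug A -> gal x = 0.
Proof.
apply: (zspan_ker (f := gal)) => _ [h [a [/andP[aA /eqP ea] ->]]].
by rewrite [LHS](gal_mulA h aA) ea scale0r.
Qed.

(** The left side is [x₁ ⊗ S(x₂) x₃], contracted by the antipode axiom. So [x ⊗ 1] is recovered from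
    [π(x₁) ⊗ x₂]. *)
Lemma gal_comul x : tlift (fun p y => hhr (gal p) y) (hcomul x) = hh x 1.
Proof.
have [hhDl hhDr hhZl hhZr] := hh_bilin.
rewrite (@comul3 _ _ _ (fun u y => hhr (hh_antipode u) y)
  (fun p v => hh p (tmult ((antipode H ⊠ lid H) v)))).
- under eq_tlift => p y do rewrite antipodel hhZr -hhZl.
  rewrite -[x in RHS]hcounitr.
  by rewrite -[RHS]/(hpurel _ (tlift _ _)) linear_tlift //; exact: tcontr_bilin.
- exact: (bilin_comp hh_antipode (lid H) hhr_bilin).
- exact: (bilin_comp (lid H) (tmult (A := H) \o (antipode H ⊠ lid H))%FUN
    hh_bilin).
- by move=> p q y; rewrite hh_antipode_pure hhr_hh tmap_pure tmult_pure.
Qed.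

(** For coinvariant [x] the element [π(x₁) ⊗ x₂] is [π(1) ⊗ x]; the map that recovers [x ⊗ 1] from
    it also sends it to [1 ⊗ x]. *)
Lemma hh_coinv x : x \in coinv A -> hh x 1 = hh 1 x.
Proof.
pose galC : {linear quotmod (Haug A) -> hind AH} :=
  HB.pack_for {linear quotmod (Haug A) -> hind AH} (quot_lift gal)
    (GRing.isLinear.Build k (quotmod (Haug A)) (hind AH) _ (quot_lift gal)
      (quot_lift_is_linear gal_ker)).
have galC_pi y : galC (cpi y) = gal y by exact: (quot_lift_pi gal_ker).
have B := bilin_comp galC (lid H) hhr_bilin.
have B' := bilin_comp gal (lid H) hhr_bilin.
have E t : tlift (fun c y => hhr (galC c) y) ((cpi ⊠ lid H) t) =
    tlift (fun p y => hhr (gal p) y) t.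
  elim/tens_ind: t => [p y|s t hs ht]; last first.
    by rewrite tmapD (tliftD B) (tliftD B') hs ht.
  by rewrite tmap_pure (tlift_pure B) (tlift_pure B') galC_pi.
move=> /coinvP xC; rewrite -gal_comul -E xC (tlift_pure B) galC_pi.
by rewrite /gal /= hcomul1 hh_antipode_pure hhr_hh antipode1 mul1r.
Qed.

Definition coinv_lval_fun (s : AC) : AH := val (s : subalg (coinv A)).

Fact coinv_lval_is_linear : linear coinv_lval_fun.
Proof. by []. Qed.

HB.instance Definition _ := GRing.isLinear.Build (subalg A) AC AH _
  coinv_lval_fun coinv_lval_is_linear.

Lemma coinv_incl_epi :
  right_flat HA -> coflat (hopf_rcomodule A) -> ring_epi (coinv_incl A).
Proof.
move=> H_flat H_coflat; apply: ring_epi_rpure => s.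
apply: (coinv_ind_inj H_flat H_coflat); rewrite !coinv_ind_pure.
(* Flatness of [H] is applied to the inclusion of [A'] into [H] as left [A]-modules. *)
have inj : injective (hind_map (coinv_lval_fun : {linear AC -> AH})).
  by apply: (right_flat_injective H_flat) => x y /val_inj.
apply: inj; rewrite !hind_map_pure.
exact: hh_coinv (valP s).
Qed.

End Epi.

Theorem corollary10p4 (k : fieldType) (H : hopfAlgebra k)
    (A : rcoidSubalgebra H)
    (antipode_bij : bijective (antipode H))
    (H_flat : right_flat (pullback_rmod (subalg_incl A)))
    (H_coflat : coflat (hopf_rcomodule A)) :
  perfect_left_localization (coinv_incl A).
Proof. by split; [exact: coinv_flat | exact: coinv_incl_epi]. Qed.
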